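(* Let $\Theta_1$ and $\Theta_2$ be closed IIMLL proof nets with the same conclusion and with an order less than 4 such that $\Theta_1 \neq \Theta_2$. Then there is a one-hole context $C[]$ such that $C[\Theta_1[p \multimap (p \multimap p) \multimap (p \multimap p) \multimap p/p]] = \underline{0}$ and $C[\Theta_2[p \multimap (p \multimap p) \multimap (p \multimap p) \multimap p/p]] = \underline{1}$.
   Context: IMLL formulas are built from one atom $p$ with $\otimes$ and $⅋$ (par), with polarities; $(A\otimes B)^-$ and $(A⅋B)^+$ are written as linear implications $A \multimap B$. IIMLL proof nets are IMLL proof nets built without $\otimes^+$- and $⅋^-$-links (the purely implicational fragment). Nets are identified with their normal forms (cut elimination plus multiplicative $\eta$-expansion); closed means exactly one conclusion. The order of a formula is defined by $\mathrm{order}(p)=1$ and $\mathrm{order}(A_1 \multimap \cdots \multimap A_n \multimap p) = \max_i \mathrm{order}(A_i) + 1$; the order of a closed net is the order of its conclusion. Equality $=$ of normal nets is the paper's equality via main paths, heads and direct subproof nets (corresponding to $\beta\eta$-equality of linear $\lambda$-terms up to renaming of free variables). A one-hole context $C[]$ is an extended IIMLL proof net with exactly one hole axiom; $C[\Theta]$ plugs $\Theta$ into it. $\Theta[A/p]$ replaces every occurrence of $p$ by $A$. $\underline{0}$ and $\underline{1}$ are the two closed normal nets of $p \multimap (p \multimap p) \multimap (p \multimap p) \multimap p$, corresponding to $\lambda x.\lambda f.\lambda g.\, g(f x)$ and $\lambda x.\lambda f.\lambda g.\, f(g x)$. *)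

(* Defs.v *)
From HB Require Import structures.
From mathcomp Require Import all_boot.
From Stdlib Require Import PeanoNat Relation_Operators.

Set Implicit Arguments.
Unset Strict Implicit.
Unset Printing Implicit Defensive.

(* Implicational formulas. At polarity + the formula [A ⊸ B] is A^- ⅋ B^+, at
   polarity - it is A^+ ⊗ B^-. *)
Inductive formula := Atom | Limp of formula & formula.

Declare Scope iimll_scope.
Delimit Scope iimll_scope with iimll.
Notation "A ⊸ B" := (Limp A B) (at level 60, right associativity) : iimll_scope.
Open Scope iimll_scope.

Lemma formula_eq_dec : comparable formula.
Proof. by move=> A B; rewrite /decidable; decide equality. Defined.
HB.instance Definition _ := hasDecEq.Build formula (compareP formula_eq_dec).

Fixpoint formula_order (A : formula) : nat :=
  if A is A1 ⊸ A2 then maxn (formula_order A1).+1 (formula_order A2) else 1.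

Lemma order_args (As : seq formula) :
  formula_order (foldr Limp Atom As) = (\max_(A <- As) formula_order A).+1.
Proof.
elim: As => [|A As IH]; first by rewrite big_nil.
by rewrite big_cons /= IH maxnSS.
Qed.

Fixpoint fsubst (B A : formula) : formula :=
  if A is A1 ⊸ A2 then fsubst B A1 ⊸ fsubst B A2 else B.

(* Formula occurrences are named by natural numbers; a net is a finite
   collection of links sharing occurrences.
   - [Id a b A]: conclusions a : A^+ and b : A^-;
   - [Cut a b A]: premises a : A^+ and b : A^-;
   - [TensN a b c A B]: the ⊗^- link with premises a : A^+ and b : B^-,
     and conclusion c : (A ⊸ B)^-;
   - [ParP a b c A B]: the ⅋^+ link with premises a : A^- and b : B^+,
     and conclusion c : (A ⊸ B)^+;
   - [Hole a A]: the hole axiom, with the single conclusion a : A^+, to be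
     filled by closed nets. *)
Inductive link :=
| Id of nat & nat & formula
| Cut of nat & nat & formula
| TensN of nat & nat & nat & formula & formula
| ParP of nat & nat & nat & formula & formula
| Hole of nat & formula.

Lemma link_eq_dec : comparable link.
Proof.
by move=> l l'; rewrite /decidable;
  decide equality; (exact: formula_eq_dec || exact: PeanoNat.Nat.eq_dec).
Defined.
HB.instance Definition _ := hasDecEq.Build link (compareP link_eq_dec).

Definition link_names (l : link) : seq nat :=
  match l with
  | Id a b _ | Cut a b _ => [:: a; b]
  | TensN a b c _ _ | ParP a b c _ _ => [:: a; b; c]
  | Hole a _ => [:: a]
  end.

Definition names (L : seq link) : seq nat := flatten (map link_names L).

Definition link_map (f : nat -> nat) (g : formula -> formula) (l : link) : link :=
  match l with
  | Id a b A => Id (f a) (f b) (g A)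
  | Cut a b A => Cut (f a) (f b) (g A)
  | TensN a b c A B => TensN (f a) (f b) (f c) (g A) (g B)
  | ParP a b c A B => ParP (f a) (f b) (f c) (g A) (g B)
  | Hole a A => Hole (f a) (g A)
  end.

Definition is_hole (l : link) : bool := if l is Hole _ _ then true else false.

(* A named, polarized formula; [true] is the polarity +. *)
Definition occurrence : Type := (nat * (bool * formula))%type.
Definition pos (a : nat) (A : formula) : occurrence := (a, (true, A)).
Definition neg (a : nat) (A : formula) : occurrence := (a, (false, A)).

Definition disjoint_names (L1 L2 : seq link) : bool :=
  ~~ has (mem (names L1)) (names L2).

(* [extended_net L G]: the links L form an extended IIMLL proof net whose
   conclusions are G. Links and conclusions are unordered. *)
Inductive extended_net : seq link -> seq occurrence -> Prop :=
| net_id a b A :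
    a != b -> extended_net [:: Id a b A] [:: pos a A; neg b A]
| net_hole a A :
    extended_net [:: Hole a A] [:: pos a A]
| net_cut L1 L2 G1 G2 a b A :
    extended_net L1 (pos a A :: G1) ->
    extended_net L2 (neg b A :: G2) ->
    disjoint_names L1 L2 ->
    extended_net (Cut a b A :: L1 ++ L2) (G1 ++ G2)
| net_tens L1 L2 G1 G2 a b c A B :
    extended_net L1 (pos a A :: G1) ->
    extended_net L2 (neg b B :: G2) ->
    disjoint_names L1 L2 ->
    c \notin names (L1 ++ L2) ->
    extended_net (TensN a b c A B :: L1 ++ L2) (neg c (A ⊸ B) :: G1 ++ G2)
| net_par L G a b c A B :
    extended_net L (neg a A :: pos b B :: G) ->
    c \notin names L ->
    extended_net (ParP a b c A B :: L) (pos c (A ⊸ B) :: G)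
| net_perm L L' G G' :
    perm_eq L L' -> perm_eq G G' -> extended_net L G -> extended_net L' G'.

(* Links together with the name of their unique conclusion. *)
Record rooted := Rooted { links : seq link; ccl : nat }.

Definition closed_extended_net (T : rooted) (A : formula) : Prop :=
  extended_net (links T) [:: pos (ccl T) A].

Definition closed_net (T : rooted) (A : formula) : Prop :=
  closed_extended_net T A /\ ~~ has is_hole (links T).

Definition one_hole_context (C : rooted) (H A : formula) : Prop :=
  [/\ closed_extended_net C A,
      count is_hole (links C) = 1
    & exists h, Hole h H \in links C].

Definition net_subst (B : formula) (T : rooted) : rooted :=
  Rooted (map (link_map id (fsubst B)) (links T)) (ccl T).

(* The names of T are shifted away from those of C, except for its conclusion,
   which is identified with the conclusion of the hole. *)
Definition plug (C T : rooted) : rooted :=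
  let m := (\max_(x <- names (links C)) x).+1 in
  let fill l :=
    if l is Hole h _ then
      map (link_map (fun x => if x == ccl T then h else x + m) id) (links T)
    else [:: l] in
  Rooted (flatten (map fill (links C))) (ccl C).

Definition rename (c d : nat) : link -> link :=
  link_map (fun x => if x == c then d else x) id.

(* Cut elimination and multiplicative η-expansion. In the two identity cases
   the occurrence c, which was a premise of the erased cut, is identified with
   the other conclusion of the erased axiom; the names of the conclusions of
   the net never change. *)
Inductive step (L : seq link) : seq link -> Prop :=
| step_id_pos a b c A L0 :
    perm_eq L [:: Id a b A, Cut a c A & L0] ->
    step L (map (rename c b) L0)
| step_id_neg a b c A L0 :
    perm_eq L [:: Id a b A, Cut c b A & L0] ->
    step L (map (rename c a) L0)
| step_mult a b c a' b' c' A B L0 :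
    perm_eq L [:: TensN a b c A B, ParP a' b' c' A B, Cut c' c (A ⊸ B) & L0] ->
    step L [:: Cut a a' A, Cut b' b B & L0]
| step_eta c d a a' b b' A B L0 :
    perm_eq L (Id c d (A ⊸ B) :: L0) ->
    uniq [:: a; a'; b; b'] ->
    ~~ has (mem (names L)) [:: a; a'; b; b'] ->
    step L [:: Id a a' A, Id b b' B, ParP a' b c A B, TensN a b' d A B & L0].

Definition is_normal (L : seq link) : Prop := forall L', ~ step L L'.

Definition normal_form (L N : seq link) : Prop :=
  clos_refl_trans _ step L N /\ is_normal N.

(* [main_up L x xs y]: going up from the positive occurrence x through ⅋^+
   links one reaches y; xs lists the negative premises of these links. *)
Inductive main_up (L : seq link) : nat -> seq nat -> nat -> Prop :=
| up_nil y : main_up L y [::] y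
| up_cons a b c A B xs y :
    ParP a b c A B \in L -> main_up L b xs y -> main_up L c (a :: xs) y.

(* [main_down L z us h]: going down from the negative occurrence z through
   ⊗^- links one ends at h; us lists the positive premises of these links. *)
Inductive main_down (L : seq link) : nat -> seq nat -> nat -> Prop :=
| down_nil h :
    (forall a c A B, TensN a h c A B \notin L) -> main_down L h [::] h
| down_cons a b c A B us h :
    TensN a b c A B \in L -> main_down L c us h -> main_down L b (a :: us) h.

(* The main path from the positive conclusion x goes up to an axiom, crosses
   it, and goes down to the head h. The direct subproof nets are the subnets
   whose positive conclusions are the occurrences in us. *)
Definition main_path (L : seq link) (x : nat) (xs us : seq nat) (h : nat) : Prop :=
  exists y z, [/\ main_up L x xs y, Id y z Atom \in L & main_down L z us h].

(* Equality of the subnets of the normal nets L and L' with positive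
   conclusions x and x'; r relates their negative conclusions, as a renaming
   of free variables. *)
Inductive eq_normal (L L' : seq link) : seq (nat * nat) -> nat -> nat -> Prop :=
| eq_normal_intro r x x' xs xs' us us' h h' :
    main_path L x xs us h ->
    main_path L' x' xs' us' h' ->
    size xs = size xs' ->
    size us = size us' ->
    (h, h') \in zip xs xs' ++ r ->
    (forall u u', (u, u') \in zip us us' ->
       eq_normal L L' (zip xs xs' ++ r) u u') ->
    eq_normal L L' r x x'.

(* Equality of closed nets, each identified with its normal form. *)
Definition net_eq (T T' : rooted) : Prop :=
  exists N N', [/\ normal_form (links T) N, normal_form (links T') N'
                 & eq_normal N N' [::] (ccl T) (ccl T')].

Definition boolF : formula :=
  Atom ⊸ (Atom ⊸ Atom) ⊸ (Atom ⊸ Atom) ⊸ Atom.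

(* The abstraction λx.λf.λg over occurrences x = 0, f = 1, g = 2 and a body 3,
   with conclusion 6. *)
Definition bool_abs : seq link :=
  [:: ParP 2 3 4 (Atom ⊸ Atom) Atom;
      ParP 1 4 5 (Atom ⊸ Atom) ((Atom ⊸ Atom) ⊸ Atom);
      ParP 0 5 6 Atom ((Atom ⊸ Atom) ⊸ (Atom ⊸ Atom) ⊸ Atom)].

(* λx.λf.λg. g (f x) *)
Definition zero_net : rooted :=
  Rooted ([:: Id 7 0 Atom; TensN 7 8 1 Atom Atom;
              Id 9 8 Atom; TensN 9 10 2 Atom Atom;
              Id 3 10 Atom] ++ bool_abs) 6.

(* λx.λf.λg. f (g x) *)
Definition one_net : rooted :=
  Rooted ([:: Id 7 0 Atom; TensN 7 8 2 Atom Atom;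
              Id 9 8 Atom; TensN 9 10 1 Atom Atom;
              Id 3 10 Atom] ++ bool_abs) 6.

(* Main.v *)
Require Import Defs.
From mathcomp Require Import all_boot zify.
From Stdlib Require Cantor.
From Stdlib Require Import Relation_Operators.

Set Implicit Arguments.
Unset Strict Implicit.
Unset Printing Implicit Defensive.

(* A closed normal net whose conclusion has order at most 3 is a linear
   applicative term: each bound variable x_i is a first-order function symbol
   occurring exactly once. Two distinct terms have a first position where their
   heads a and b differ. Substitute for the variables on the path to that
   position the projections along the path, for a and b the constants 0 and 1,
   and any constant elsewhere. Booleans can be erased linearly, since c x I I
   reduces to x for both booleans c, so projections and constants exist on boolF; by linearity a and
   b are not on the path, and the two terms evaluate to 0 and 1.

   The normal form of C[T] is not computed. Every net has a normal form, and a
   normal closed net of type boolF is 0 or 1. Experiments (points of the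
   relational semantics) are preserved by reduction in both directions and
   tell these two nets apart, so it is enough to exhibit an experiment of C[T]
   whose result is a point of 0 but not of 1, or conversely. *)

(** * Wiring and subnets *)

(** The same context must serve both terms, although they need different evaluations. Labels
    therefore come as functions [bool -> nat]: one net carries two experiments, that at [false] for
    the first term and that at [true] for the second. A constant that matters in one experiment is
    at the common point in the other, and so is every boolean that is erased; this is why a point
    shared by 0 and 1 is required. The order bound makes each argument of a head atomic:
    abstractions then occur only at the root, and replacing [p] by [boolF] turns every bound
    variable into a first-order function on booleans. On the side of nets, the obstacle is that a
    derivation may bury the links of a redex under unrelated rules, so each reduction step rests on
    replacing a subnet inside a derivation. Experiments also have to be carried backwards, because
    the term is read from the normal form while the net that gets plugged is the given one. *)

Ltac perm_by_count :=
  let p := fresh "p" in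
  apply/permP => p;
  repeat match goal with H : is_true (perm_eq _ _) |- _ =>
    move/permP: H => /(_ p); rewrite ?count_cat /= ?count_cat /= => ? end;
  rewrite ?count_cat /= ?count_cat /= ?count_cat;
  repeat match goal with H : ?P |- _ =>
    lazymatch type of P with Prop =>
      lazymatch P with @eq nat _ _ => fail | _ => clear H end end end;
  lia.

Definition conclusions (l : link) : seq occurrence :=
  match l with
  | Id a b A => [:: pos a A; neg b A]
  | Cut _ _ _ => [::]
  | TensN _ _ c A B => [:: neg c (A ⊸ B)]
  | ParP _ _ c A B => [:: pos c (A ⊸ B)]
  | Hole a A => [:: pos a A]
  end.

Definition premises (l : link) : seq occurrence :=
  match l with
  | Cut a b A => [:: pos a A; neg b A]
  | TensN a b _ A B => [:: pos a A; neg b B]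
  | ParP a b _ A B => [:: neg a A; pos b B]
  | _ => [::]
  end.

Definition concls (L : seq link) := flatten (map conclusions L).
Definition prems (L : seq link) := flatten (map premises L).

Lemma names_cat L1 L2 : names (L1 ++ L2) = names L1 ++ names L2.
Proof. by rewrite /names map_cat flatten_cat. Qed.

Lemma concls_cat L1 L2 : concls (L1 ++ L2) = concls L1 ++ concls L2.
Proof. by rewrite /concls map_cat flatten_cat. Qed.

Lemma prems_cat L1 L2 : prems (L1 ++ L2) = prems L1 ++ prems L2.
Proof. by rewrite /prems map_cat flatten_cat. Qed.

Lemma perm_names L L' : perm_eq L L' -> perm_eq (names L) (names L').
Proof. by move=> h; apply: perm_flatten; apply: perm_map. Qed.

Lemma perm_concls L L' : perm_eq L L' -> perm_eq (concls L) (concls L').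
Proof. by move=> h; apply: perm_flatten; apply: perm_map. Qed.

Lemma perm_prems L L' : perm_eq L L' -> perm_eq (prems L) (prems L').
Proof. by move=> h; apply: perm_flatten; apply: perm_map. Qed.

Lemma names_perm L :
  perm_eq (names L) (unzip1 (concls L) ++ unzip1 (prems L)).
Proof.
elim: L => [|l L IH] //.
rewrite -cat1s names_cat concls_cat prems_cat /unzip1 !map_cat.
rewrite /unzip1 in IH.
by case: l => [a b A|a b A|a b c A B|a b c A B|a A] /=; perm_by_count.
Qed.

Lemma disjoint_namesP L1 L2 :
  reflect (forall x, x \in names L1 -> x \in names L2 -> False)
          (disjoint_names L1 L2).
Proof.
apply: (iffP hasPn) => /= [h x h1 /h /= /negP|h x h2]; first exact.
by apply/negP => h1; apply: h h2.
Qed.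

(** The local part of correctness: each occurrence is produced by exactly one link and consumed
    exactly once, by a link or by the outside. It does not depend on the order in which a derivation
    adds the links. *)
Definition wired (L : seq link) (G : seq occurrence) : Prop :=
  perm_eq (concls L) (prems L ++ G) /\ uniq (unzip1 (concls L)).

Lemma mem_names_concls L G x :
  wired L G -> (x \in names L) = (x \in unzip1 (concls L)).
Proof.
case=> hp _; rewrite (perm_mem (names_perm L)) mem_cat.
apply/orP/idP => [[//|]|->]; last by left.
move=> hx; rewrite (perm_mem (perm_map fst hp)) map_cat mem_cat.
by rewrite /unzip1 in hx; rewrite hx.
Qed.

(** [X] stands for the premises of the link about to join the two nets. *)
Lemma wired_cat L1 L2 G1 G2 G X :
  wired L1 G1 -> wired L2 G2 -> disjoint_names L1 L2 ->
  perm_eq (G1 ++ G2) (X ++ G) ->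
  perm_eq (concls (L1 ++ L2)) (X ++ prems (L1 ++ L2) ++ G)
  /\ uniq (unzip1 (concls (L1 ++ L2))).
Proof.
move=> w1 w2 /disjoint_namesP dis hG; case: (w1) (w2) => [p1 u1] [p2 u2].
rewrite concls_cat prems_cat; split; first by perm_by_count.
rewrite /unzip1 map_cat cat_uniq u1 u2 andbT /=.
apply/hasPn => x h2; apply/negP => h1; apply: (dis x).
  by rewrite (mem_names_concls _ w1).
by rewrite (mem_names_concls _ w2).
Qed.

Lemma net_wired L G : extended_net L G -> wired L G.
Proof.
elim=> {L G} [a b A nab|a A|L1 L2 G1 G2 a b A _ w1 _ w2 dis
  |L1 L2 G1 G2 a b c A B _ w1 _ w2 dis nc|L G a b c A B _ w nc|L L' G G' pL pG _ w].
- by split=> //=; rewrite inE nab.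
- by [].
- have [|p u] := @wired_cat _ _ _ _ (G1 ++ G2) [:: pos a A; neg b A] w1 w2 dis.
    by perm_by_count.
  by split.
- have [|p u] := @wired_cat _ _ _ _ (G1 ++ G2) [:: pos a A; neg b B] w1 w2 dis.
    by perm_by_count.
  split; first by rewrite /concls /prems /=; rewrite -/(concls _) -/(prems _); perm_by_count.
  rewrite /= u andbT; apply: contra nc => hc.
  by rewrite (perm_mem (names_perm _)) mem_cat hc.
- case: w => p u; split.
    by rewrite /concls /prems /=; rewrite -/(concls _) -/(prems _); perm_by_count.
  rewrite /= u andbT; apply: contra nc => hc.
  by rewrite (perm_mem (names_perm _)) mem_cat hc.
- case: w => p u; split.
    by have := perm_concls pL; have := perm_prems pL => ? ?; perm_by_count.
  by rewrite -(perm_uniq (perm_map fst (perm_concls pL))).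
Qed.

(** * Subnets that end in a chosen link *)

Lemma perm_cat_refine (T : eqType) (A B C D : seq T) :
  perm_eq (A ++ B) (C ++ D) ->
  exists A1 A2 B1 B2, [/\ perm_eq A (A1 ++ A2), perm_eq B (B1 ++ B2),
                          perm_eq C (A1 ++ B1) & perm_eq D (A2 ++ B2)].
Proof.
elim: A C D => [|x A IH] C D h.
  by exists [::], [::], C, D; split=> //; perm_by_count.
have : x \in C ++ D by rewrite -(perm_mem h) mem_head.
rewrite mem_cat => /orP[] /perm_to_rem hx.
  have [|A1 [A2 [B1 [B2 [h1 h2 h3 h4]]]]] := IH (rem x C) D; first by perm_by_count.
  by exists (x :: A1), A2, B1, B2; split=> //; perm_by_count.
have [|A1 [A2 [B1 [B2 [h1 h2 h3 h4]]]]] := IH C (rem x D); first by perm_by_count.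
by exists A1, (x :: A2), B1, B2; split=> //; perm_by_count.
Qed.

(** What inversion would give if [l] were the last link of the derivation of [S]. Direct inversion
    is of no help, since [net_perm] may end any derivation and the chosen link may lie deep
    inside. *)
Definition introduced_by (l : link) (S : seq link) (D : seq occurrence) : Prop :=
  match l with
  | Id a b A => [/\ a != b, S = [:: l] & perm_eq D [:: pos a A; neg b A]]
  | Cut a b A => exists L1 L2 G1 G2,
      [/\ extended_net L1 (pos a A :: G1), extended_net L2 (neg b A :: G2),
          disjoint_names L1 L2, S = l :: L1 ++ L2 & perm_eq D (G1 ++ G2)]
  | TensN a b c A B => exists L1 L2 G1 G2,
      [/\ extended_net L1 (pos a A :: G1), extended_net L2 (neg b B :: G2),
          disjoint_names L1 L2, S = l :: L1 ++ L2
        & perm_eq D (neg c (A ⊸ B) :: G1 ++ G2)]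
  | ParP a b c A B => exists L G,
      [/\ extended_net L (neg a A :: pos b B :: G), S = l :: L
        & perm_eq D (pos c (A ⊸ B) :: G)]
  | Hole _ _ => True
  end.

(* P collects the conclusions of the subnet S that are also conclusions of the
   whole net, Q those consumed by the context R. The context accepts any
   replacement of S with the same Q, whatever replaces P. *)
Definition focused (L : seq link) (G : seq occurrence) (l : link) : Prop :=
  exists S R P Q G',
    [/\ introduced_by l S (P ++ Q), perm_eq L (S ++ R), perm_eq G (P ++ G'),
        {subset Q <= prems R}
      & forall S' P', extended_net S' (P' ++ Q) ->
          (forall x, x \in names S' -> x \in names S \/ x \notin names L) ->
          extended_net (S' ++ R) (P' ++ G')].

Lemma introduced_by_perm l S D D' :
  perm_eq D D' -> introduced_by l S D -> introduced_by l S D'.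
Proof.
rewrite perm_sym => pD; case: l => [a b A|a b A|a b c A B|a b c A B|a A] //=.
- by case=> ? ? /(perm_trans pD).
- move=> [L1 [L2 [G1 [G2 [? ? ? ? /(perm_trans pD)]]]]].
  by exists L1, L2, G1, G2.
- move=> [L1 [L2 [G1 [G2 [? ? ? ? /(perm_trans pD)]]]]].
  by exists L1, L2, G1, G2.
- by move=> [L1 [G1 [? ? /(perm_trans pD)]]]; exists L1, G1.
Qed.

Lemma focused_here L G l : introduced_by l L G -> focused L G l.
Proof.
move=> h; exists L, [::], G, [::], [::]; rewrite !cats0.
split=> // S' P'; by rewrite !cats0.
Qed.

Lemma focused_perm L L' G G' l :
  perm_eq L L' -> perm_eq G G' -> focused L G l -> focused L' G' l.
Proof.
move=> pL pG [S [R [P [Q [H [h1 h2 h3 h4 h5]]]]]]; exists S, R, P, Q, H; split=> //.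
- by perm_by_count.
- by perm_by_count.
- move=> S' P' hn hx; apply: h5 => // x /hx.
  by rewrite (perm_mem (perm_names pL)).
Qed.

(** The induction step shared by the rules: [Z] collects the links that a rule puts around [L1],
    consuming [F] and producing [H]. The part of [P] that lies in [F] moves to [Q]. *)
Lemma focused_wrap L1 F G1 Z H l :
  (forall L G, extended_net L (F ++ G) ->
     (forall x, x \in names L -> x \in names L1 \/ x \notin names (Z ++ L1)) ->
     extended_net (Z ++ L) (H ++ G)) ->
  {subset F <= prems Z} ->
  focused L1 (F ++ G1) l -> focused (Z ++ L1) (H ++ G1) l.
Proof.
move=> wrap FZ [S [R [P [Q [K [h1 h2 h3 h4 h5]]]]]].
have [F1 [F2 [P0 [K0 [f1 f2 f3 f4]]]]] := perm_cat_refine h3.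
exists S, (Z ++ R), P0, (F1 ++ Q), (H ++ K0); split.
- apply: introduced_by_perm h1; perm_by_count.
- perm_by_count.
- perm_by_count.
- move=> o; rewrite prems_cat !mem_cat => /orP[oF|/h4 ->]; last by rewrite orbT.
  by rewrite FZ // (perm_mem f1) mem_cat oF.
- move=> S' P' hn hx.
  have sub x : x \in names S -> x \in names L1.
    by rewrite (perm_mem (perm_names h2)) names_cat mem_cat => ->.
  have n1 : extended_net (S' ++ R) ((P' ++ F1) ++ K).
    apply: h5 => [|x /hx[]]; [by rewrite -catA|by left|].
    by rewrite names_cat mem_cat negb_or => /andP[_ ?]; right.
  have n2 : extended_net (Z ++ (S' ++ R)) (H ++ (P' ++ K0)).
    apply: wrap => [|x].
      by apply: net_perm n1 => //; perm_by_count.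
    rewrite names_cat mem_cat => /orP[/hx[/sub|]|hR]; [by left|by right|].
    by left; rewrite (perm_mem (perm_names h2)) names_cat mem_cat hR orbT.
  by apply: net_perm n2; perm_by_count.
Qed.

(** The rest of the derivation is replayed over the replacement. Its side conditions survive because
    each name of the replacement either was in the old subnet or is foreign to the whole net. *)
Lemma net_focused L G l : extended_net L G -> l \in L -> focused L G l.
Proof.
move=> net; elim: net l => {L G} [a b A nab|a A|L1 L2 G1 G2 a b A n1 IH1 n2 IH2 dis
  |L1 L2 G1 G2 a b c A B n1 IH1 n2 IH2 dis nc|L G a b c A B n IH nc
  |L L' G G' pL pG _ IH] l.
- by rewrite inE => /eqP ->; apply: focused_here.
- by rewrite inE => /eqP ->; apply: focused_here.
- rewrite inE mem_cat => /or3P[/eqP->|h|h].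
  + by apply: focused_here; exists L1, L2, G1, G2.
  + apply: (@focused_perm ((Cut a b A :: L2) ++ L1) _ (G2 ++ G1)); try perm_by_count.
    apply: (@focused_wrap _ [:: pos a A]); last exact: IH1.
      move=> L G nL hx; apply: net_perm (net_cut (a := a) (b := b) nL n2 _); try perm_by_count.
      apply/disjoint_namesP => x /hx[].
        by move=> h1 h2; move/disjoint_namesP: dis => /(_ x h1 h2).
      by rewrite names_cat mem_cat negb_or -cat1s names_cat mem_cat negb_or
         => /andP[/andP[_ /negP]].
    by move=> o; rewrite inE => /eqP->; rewrite inE eqxx.
  + apply: (@focused_perm ((Cut a b A :: L1) ++ L2) _ (G1 ++ G2)); try perm_by_count.
    apply: (@focused_wrap _ [:: neg b A]); last exact: IH2.
      move=> L G nL hx; apply: net_perm (net_cut (a := a) (b := b) n1 nL _); try perm_by_count.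
      apply/disjoint_namesP => x h1 /hx[].
        by move=> h2; move/disjoint_namesP: dis => /(_ x h1 h2).
      by rewrite names_cat mem_cat negb_or -cat1s names_cat mem_cat negb_or h1 andbF.
    by move=> o; rewrite inE => /eqP->; rewrite !inE eqxx orbT.
- rewrite inE mem_cat => /or3P[/eqP->|h|h].
  + by apply: focused_here; exists L1, L2, G1, G2.
  + apply: (@focused_perm ((TensN a b c A B :: L2) ++ L1) _ ((neg c (A ⊸ B) :: G2) ++ G1)); try perm_by_count.
    apply: (@focused_wrap _ [:: pos a A]); last exact: IH1.
      move=> L G nL hx; apply: net_perm (net_tens (a := a) (b := b) (c := c) nL n2 _ _); try perm_by_count.
        apply/disjoint_namesP => x /hx[].
          by move=> h1 h2; move/disjoint_namesP: dis => /(_ x h1 h2).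
        by rewrite names_cat mem_cat negb_or -cat1s names_cat mem_cat negb_or
           => /andP[/andP[_ /negP]].
      move: nc; rewrite !names_cat !mem_cat !negb_or => /andP[nc1 ->]; rewrite andbT.
      apply/negP => /hx[]; first exact/negP.
      by rewrite names_cat mem_cat -cat1s names_cat mem_cat !inE eqxx !orbT.
    by move=> o; rewrite inE => /eqP->; rewrite inE eqxx.
  + apply: (@focused_perm ((TensN a b c A B :: L1) ++ L2) _ ((neg c (A ⊸ B) :: G1) ++ G2)); try perm_by_count.
    apply: (@focused_wrap _ [:: neg b B]); last exact: IH2.
      move=> L G nL hx; apply: net_perm (net_tens (a := a) (b := b) (c := c) n1 nL _ _); try perm_by_count.
        apply/disjoint_namesP => x h1 /hx[].
          by move=> h2; move/disjoint_namesP: dis => /(_ x h1 h2).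
        by rewrite names_cat mem_cat negb_or -cat1s names_cat mem_cat negb_or h1 andbF.
      move: nc; rewrite !names_cat !mem_cat !negb_or => /andP[-> nc2] /=.
      apply/negP => /hx[]; first exact/negP.
      by rewrite names_cat mem_cat -cat1s names_cat mem_cat !inE eqxx !orbT.
    by move=> o; rewrite inE => /eqP->; rewrite !inE eqxx orbT.
- rewrite inE => /orP[/eqP->|h].
    by apply: focused_here; exists L, G.
  apply: (@focused_wrap _ [:: neg a A; pos b B] _ [:: ParP a b c A B] [:: pos c (A ⊸ B)]);
    last exact: IH.
    move=> L' G' nL hx; apply: (net_par (a := a) (b := b) nL).
    apply/negP => /hx[]; first exact/negP.
    by rewrite names_cat mem_cat !inE eqxx !orbT.
  by move=> o; rewrite !inE.
- rewrite -(perm_mem pL) => /IH; exact: focused_perm.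
Qed.

(** * Experiments and reduction of axiom cuts *)

Lemma names_link_map f g L : names (map (link_map f g) L) = map f (names L).
Proof.
elim: L => [|l L IH] //; rewrite /names /= -/(names _) -/(names L) map_cat.
by congr (_ ++ _); [case: l|].
Qed.

Definition occ_map (f : nat -> nat) (g : formula -> formula) (o : occurrence) :
  occurrence := (f o.1, (o.2.1, g o.2.2)).

Lemma net_map f g L G :
  (forall A B, g (A ⊸ B) = g A ⊸ g B) ->
  extended_net L G -> {in names L &, injective f} ->
  extended_net (map (link_map f g) L) (map (occ_map f g) G).
Proof.
move=> gM; elim=> {L G} [a b A nab|a A|L1 L2 G1 G2 a b A n1 IH1 n2 IH2 dis
  |L1 L2 G1 G2 a b c A B n1 IH1 n2 IH2 dis nc|L G a b c A B n IH nc
  |L L' G G' pL pG _ IH] inj.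
- apply: net_id; apply: contra nab => /eqP /inj -> //; by rewrite !inE eqxx ?orbT.
- exact: net_hole.
- rewrite /= !map_cat; apply: net_cut (IH1 _) (IH2 _) _.
  + by move=> x y hx hy; apply: inj; rewrite -cat1s !names_cat !mem_cat ?hx ?hy ?orbT.
  + by move=> x y hx hy; apply: inj; rewrite -cat1s !names_cat !mem_cat ?hx ?hy ?orbT.
  + apply/disjoint_namesP => x; rewrite !names_link_map => /mapP[y hy ->] /mapP[z hz] /inj yz.
    move/disjoint_namesP: dis => /(_ y hy); apply; rewrite yz //;
    by rewrite -cat1s !names_cat !mem_cat ?hz ?hy ?orbT.
- rewrite /= !map_cat /occ_map /= gM; apply: net_tens (IH1 _) (IH2 _) _ _.
  + by move=> x y hx hy; apply: inj; rewrite -cat1s !names_cat !mem_cat ?hx ?hy ?orbT.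
  + by move=> x y hx hy; apply: inj; rewrite -cat1s !names_cat !mem_cat ?hx ?hy ?orbT.
  + apply/disjoint_namesP => x; rewrite !names_link_map => /mapP[y hy ->] /mapP[z hz] /inj yz.
    move/disjoint_namesP: dis => /(_ y hy); apply; rewrite yz //;
    by rewrite -cat1s !names_cat !mem_cat ?hz ?hy ?orbT.
  + rewrite -map_cat names_link_map; apply: contra nc => /mapP[z hz] /inj -> //.
      by rewrite -cat1s names_cat mem_cat !inE eqxx !orbT.
    by rewrite -cat1s names_cat mem_cat hz orbT.
- rewrite /= /occ_map /= gM; apply: net_par (IH _) _.
  + by move=> x y hx hy; apply: inj; rewrite -cat1s !names_cat !mem_cat ?hx ?hy ?orbT.
  + rewrite names_link_map; apply: contra nc => /mapP[z hz] /inj -> //.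
      by rewrite -cat1s names_cat mem_cat !inE eqxx !orbT.
    by rewrite -cat1s names_cat mem_cat hz orbT.
- apply: net_perm (IH _); try exact: perm_map.
  by move=> x y; rewrite !(perm_mem (perm_names pL)); exact: inj.
Qed.

Lemma wired_uniq_conclusions L G :
  wired L G -> uniq (unzip1 (prems L ++ G)).
Proof. by case=> p u; rewrite -(perm_uniq (perm_map fst p)). Qed.

Lemma conclusionsP L o : reflect (exists2 l, l \in L & o \in conclusions l) (o \in concls L).
Proof.
apply: (iffP flattenP) => [[s /mapP[l hl ->] ho]|[l hl ho]]; first by exists l.
by exists (conclusions l) => //; apply: map_f.
Qed.

Lemma premisesP L o : reflect (exists2 l, l \in L & o \in premises l) (o \in prems L).
Proof.
apply: (iffP flattenP) => [[s /mapP[l hl ->] ho]|[l hl ho]]; first by exists l.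
by exists (premises l) => //; apply: map_f.
Qed.

Lemma conclusion_link L G o :
  wired L G -> o \in prems L ++ G -> exists2 l, l \in L & o \in conclusions l.
Proof. by case=> p _; rewrite -(perm_mem p) => /conclusionsP. Qed.

Lemma conclusion_link_inj L G l l' o o' :
  wired L G -> l \in L -> l' \in L -> o \in conclusions l -> o' \in conclusions l' ->
  o.1 = o'.1 -> l = l'.
Proof.
move=> [_ u] hl hl' ho ho' eo; apply/eqP/negPn/negP => ne.
have pl := perm_to_rem hl.
have hr : l' \in rem l L.
  by move: hl'; rewrite (perm_mem pl) inE eq_sym (negbTE ne).
move: u; rewrite (perm_uniq (perm_map fst (perm_concls pl))) /=.
rewrite /concls /= map_cat cat_uniq => /and3P[_ /hasPn h _].
have /h/negP : o'.1 \in unzip1 (concls (rem l L)).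
  by apply: map_f; apply/conclusionsP; exists l'.
by apply; rewrite -eo; apply: map_f.
Qed.

(** Production and consumption happen once each, so a name with both ends inside [X] has none left
    elsewhere. Names erased by a reduction can thus be relabelled freely. *)
Lemma wired_private L G X R x :
  wired L G -> perm_eq L (X ++ R) -> x \in unzip1 (concls X) -> x \in unzip1 (prems X) ->
  x \notin names R /\ x \notin unzip1 G.
Proof.
move=> w pL hc hp.
have := wired_uniq_conclusions w; case: w => _.
rewrite (perm_uniq (perm_map fst (perm_concls pL))) concls_cat map_cat cat_uniq.
move=> /and3P[_ /hasPn h1 _].
have := perm_prems pL; rewrite prems_cat => /(perm_map fst) pP.
rewrite /unzip1 map_cat cat_uniq => /and3P[u /hasPn h2 _].
move: u; rewrite (perm_uniq pP) map_cat cat_uniq => /and3P[_ /hasPn h3 _].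
split.
  rewrite (perm_mem (names_perm R)) mem_cat; apply/norP; split.
    by apply/negP => /h1 /negP.
  by apply/negP => /h3 /negP.
apply/negP => /h2 /negP; apply.
by rewrite (perm_mem pP) map_cat mem_cat; apply/orP; left.
Qed.

Lemma net_focus L G l :
  extended_net L G -> l \in L ->
  exists S R D, [/\ introduced_by l S D, perm_eq L (S ++ R)
    & forall S', extended_net S' D ->
        (forall x, x \in names S' -> x \in names S \/ x \notin names L) ->
        extended_net (S' ++ R) G].
Proof.
move=> n hl; have [S [R [P [Q [G' [h1 h2 h3 h4 h5]]]]]] := net_focused n hl.
exists S, R, (P ++ Q); split=> // S' n' fr.
by apply: net_perm (h5 _ _ n' fr) => //; rewrite perm_sym.
Qed.

(** Since [o] is a conclusion of the whole net, the context cannot consume it; it may be exchanged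
    for any list [P], even an empty or a longer one. *)
Lemma net_focus_conclusion L G l o :
  extended_net L (o :: G) -> l \in L -> ~~ is_hole l -> o \in conclusions l ->
  exists S R D, [/\ introduced_by l S (o :: D), perm_eq L (S ++ R)
    & forall S' P, extended_net S' (P ++ D) ->
        (forall x, x \in names S' -> x \in names S \/ x \notin names L) ->
        extended_net (S' ++ R) (P ++ G)].
Proof.
move=> n hl nh ho; have w := net_wired n.
have [S [R [P [Q [G' [h1 h2 h3 h4 h5]]]]]] := net_focused n hl.
have oPQ : o \in P ++ Q.
  case: l ho h1 nh {hl} => [a b A|a b A|a b c A B|a b c A B|a A] //= ho.
  - by case=> _ _ p; rewrite (perm_mem p).
  - by move: ho; rewrite inE => /eqP-> [? [? [? [? [_ _ _ _ p]]]]] _; rewrite (perm_mem p) inE eqxx.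
  - by move: ho; rewrite inE => /eqP-> [? [? [_ _ p]]] _; rewrite (perm_mem p) inE eqxx.
have oP : o \in P.
  move: oPQ; rewrite mem_cat => /orP[//|/h4 oR].
  have := wired_uniq_conclusions w; rewrite /unzip1 map_cat cat_uniq => /and3P[_ /hasPn].
  move=> /(_ o.1); rewrite /= mem_head => /(_ isT) /negP[].
  by apply: map_f; rewrite (perm_mem (perm_prems h2)) prems_cat mem_cat oR orbT.
have pP := perm_to_rem oP.
exists S, R, (rem o P ++ Q); split=> //.
  by apply: introduced_by_perm h1; perm_by_count.
move=> S' P' n' fr.
have /h5/(_ fr) n2 : extended_net S' ((P' ++ rem o P) ++ Q) by rewrite -catA.
by apply: net_perm n2 => //; perm_by_count.
Qed.

(* Sealed, because the numerals denoting nested pairs are astronomically large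
   and must never be computed. *)
Fact pairing : {f : nat * nat -> nat & {g | cancel f g & cancel g f}}.
Proof.
exists Cantor.to_nat, Cantor.of_nat; [exact: Cantor.cancel_of_to|exact: Cantor.cancel_to_of].
Qed.

Definition pair (x y : nat) : nat := projT1 pairing (x, y).
Definition pair_fst (v : nat) : nat := (s2val (projT2 pairing) v).1.
Definition pair_snd (v : nat) : nat := (s2val (projT2 pairing) v).2.

Lemma pair_inj x y x' y' : pair x y = pair x' y' -> x = x' /\ y = y'.
Proof. by move=> /(can_inj (s2valP (projT2 pairing))) [-> ->]. Qed.

Lemma pair_eta v : pair (pair_fst v) (pair_snd v) = v.
Proof. by rewrite /pair -surjective_pairing (s2valP' (projT2 pairing)). Qed.

Lemma pair_surj v : exists x y, v = pair x y.
Proof. by exists (pair_fst v), (pair_snd v); rewrite pair_eta. Qed.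

(* Experiments of the relational semantics. Since pairing is a bijection of
   nat with nat * nat, every point can be read at every formula and the labels
   need no typing. *)
Definition link_ok (e : nat -> nat) (l : link) : Prop :=
  match l with
  | Id a b _ | Cut a b _ => e a = e b
  | TensN a b c _ _ | ParP a b c _ _ => e c = pair (e a) (e b)
  | Hole _ _ => True
  end.

Definition experiment (e : nat -> nat) (L : seq link) : Prop :=
  forall l, l \in L -> link_ok e l.

Lemma link_ok_map e f g l : link_ok e (link_map f g l) <-> link_ok (e \o f) l.
Proof. by case: l. Qed.

Lemma experiment_map e f g L :
  experiment e (map (link_map f g) L) <-> experiment (e \o f) L.
Proof.
split=> h l hl; first by rewrite -(link_ok_map e f g); apply: h; apply: map_f.
by case/mapP: hl => l' hl' ->; rewrite link_ok_map; apply: h.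
Qed.

Lemma eq_in_experiment e e' L :
  {in names L, e =1 e'} -> experiment e L -> experiment e' L.
Proof.
move=> he hL l hl; have := hL l hl.
have : {in link_names l, e =1 e'}.
  by move=> x hx; apply: he; apply/flattenP; exists (link_names l) => //; apply: map_f.
by case: l {hl} => [a b A|a b A|a b c A B|a b c A B|a A] //= {}he;
  rewrite !he // !inE eqxx ?orbT.
Qed.

Lemma experiment_cat e L1 L2 :
  experiment e (L1 ++ L2) <-> experiment e L1 /\ experiment e L2.
Proof.
split=> [h|[h1 h2] l]; last by rewrite mem_cat => /orP[/h1|/h2].
by split=> l hl; apply: h; rewrite mem_cat hl ?orbT.
Qed.

Lemma experiment_cons e l L :
  experiment e (l :: L) <-> link_ok e l /\ experiment e L.
Proof.
split=> [h|[h1 h2] l']; last by rewrite inE => /orP[/eqP->|/h2].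
by split=> [|l' hl]; apply: h; rewrite inE ?eqxx ?hl ?orbT.
Qed.

Lemma experiment_perm e L L' : perm_eq L L' -> experiment e L <-> experiment e L'.
Proof. by move=> p; split=> h l; [rewrite -(perm_mem p)|rewrite (perm_mem p)]; exact: h. Qed.

Definition has_experiment (L : seq link) (G : seq occurrence) (v : nat -> nat) : Prop :=
  exists2 e, experiment e L & {in unzip1 G, e =1 v}.

Definition same_experiments L L' G : Prop :=
  forall v, has_experiment L G v <-> has_experiment L' G v.

(** An η-step trades one axiom for two smaller ones, a ⅋ and a ⊗, the last two of weight 1; the
    summand 3 makes this a strict decrease. *)
Fixpoint formula_weight (A : formula) : nat :=
  if A is A1 ⊸ A2 then formula_weight A1 + formula_weight A2 + 3 else 1.

Definition weight (L : seq link) : nat :=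
  sumn [seq if l is Id _ _ A then formula_weight A else 1 | l <- L].

Lemma weight_perm L L' : perm_eq L L' -> weight L = weight L'.
Proof. by move=> p; apply: perm_sumn; apply: perm_map. Qed.

Lemma weight_rename c d L : weight (map (rename c d) L) = weight L.
Proof. by rewrite /weight -map_comp; congr sumn; apply: eq_map; case. Qed.

Lemma rename_notin c d L : c \notin names L -> map (rename c d) L = L.
Proof.
move=> nc; rewrite -[RHS]map_id; apply/eq_in_map => l hl.
have h x : x \in link_names l -> (if x == c then d else x) = x.
  move=> hx; case: eqP => // xc; case/negP: nc.
  by apply/flattenP; exists (link_names l); rewrite -?xc //; apply: map_f.
by case: l {hl} h => [a b A|a b A|a b e A B|a b e A B|a A] /= h; rewrite /rename /=
  !h // !inE eqxx ?orbT.
Qed.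

Lemma has_hole_map f g L : has is_hole (map (link_map f g) L) = has is_hole L.
Proof. by rewrite has_map; apply: eq_has; case. Qed.

Definition reducible_to L L' G : Prop :=
  [/\ step L L', extended_net L' G, weight L' < weight L,
      has is_hole L' = has is_hole L & same_experiments L L' G].

Lemma mem_unzip1 (s : seq occurrence) o : o \in s -> o.1 \in unzip1 s.
Proof. exact: map_f. Qed.

Lemma net_conclusion_name L G o : extended_net L G -> o \in G -> o.1 \in names L.
Proof.
move=> n ho; have w := net_wired n; rewrite (mem_names_concls _ w).
by apply: mem_unzip1; case: w => p _; rewrite (perm_mem p) mem_cat ho orbT.
Qed.

(** The rule of the cut joins [L1], which holds the axiom, and [L2]. Grafting the renamed [L2] at
    the place of the axiom inside [L1] derives the reduct. *)
Lemma reduce_axiom L G a b c A :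
  extended_net L G -> Id a b A \in L -> Cut a c A \in L ->
  exists L', reducible_to L L' G.
Proof.
move=> n hI hC; have w := net_wired n.
have [S [R [D [/= [L1 [L2 [G1 [G2 [n1 n2 dis eS pD]]]]] pL close]]]] := net_focus n hC.
move/disjoint_namesP: dis => dis.
have subL1 l : l \in L1 -> l \in L.
  by move=> h; rewrite (perm_mem pL) eS mem_cat inE mem_cat h orbT.
have ha1 : a \in names L1 by apply: (net_conclusion_name (o := pos a A) n1); rewrite mem_head.
have hc2 : c \in names L2 by apply: (net_conclusion_name (o := neg c A) n2); rewrite mem_head.
have hI1 : Id a b A \in L1.
  have [|l hl hal] := @conclusion_link _ _ (pos a A) (net_wired n1).
    by rewrite mem_cat mem_head orbT.
  suff -> : Id a b A = l by [].
  by apply: (conclusion_link_inj w hI (subL1 _ hl) _ hal erefl); rewrite mem_head.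
have hb1 : b \in names L1.
  by apply/flattenP; exists [:: a; b]; [apply: (map_f link_names hI1)|rewrite !inE eqxx orbT].
have [|S1 [R1 [D1 [/= [nab eS1 pD1] pL1 close1]]]] :=
  net_focus_conclusion (o := pos a A) n1 hI1 isT; first by rewrite mem_head.
pose f x := if x == c then b else x.
have n2' : extended_net (map (rename c b) L2) (neg b A :: G2).
  have -> : neg b A :: G2 = map (occ_map f id) (neg c A :: G2).
    rewrite /= /occ_map /= /f eqxx; congr (_ :: _).
    rewrite -[LHS]map_id; apply/eq_in_map => -[x [q B]] hx /=.
    case: eqP => // xc; have := wired_uniq_conclusions (net_wired n2).
    rewrite /unzip1 map_cat cat_uniq => /and3P[_ _ /= /andP[/negP[]]].
    by rewrite -xc; apply: (mem_unzip1 hx).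
  (* Renaming [c] to [b] is injective on [L2], because [b] belongs to the disjoint [L1]. *)
  apply: net_map => // x y hx hy; rewrite /f.
  case: eqP => [->|_]; case: eqP => [->|_] // e.
    by case: (dis b) => //; rewrite e.
  by case: (dis b) => //; rewrite -e.
have pL0 : perm_eq L [:: Id a b A, Cut a c A & R1 ++ L2 ++ R].
  by rewrite eS in pL; rewrite eS1 in pL1; perm_by_count.
have [nc0 ncG] : c \notin names (R1 ++ R) /\ c \notin unzip1 G.
  apply: (wired_private (X := [:: Id a b A, Cut a c A & L2]) w).
  - by perm_by_count.
  - have h : c \in unzip1 (concls L2) by rewrite -(mem_names_concls _ (net_wired n2)).
    by rewrite /concls /= !inE; apply/orP; right; apply/orP; right; exact: h.
  - by rewrite /prems /= !inE eqxx !orbT.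
have [na0 naG] : a \notin names (R1 ++ L2 ++ R) /\ a \notin unzip1 G.
  by apply: (wired_private (X := [:: Id a b A; Cut a c A]) w pL0);
    rewrite /prems /concls /= !inE eqxx ?orbT.
have nac : a == c = false by apply/eqP => e; apply: (dis a) => //; rewrite e.
exists (map (rename c b) (R1 ++ L2 ++ R)); split.
- exact: step_id_pos pL0.
- move: nc0; rewrite names_cat mem_cat negb_or => /andP[nc1 ncR].
  rewrite !map_cat (rename_notin _ nc1) (rename_notin _ ncR).
  have n3 : extended_net (map (rename c b) L2 ++ R1) (G2 ++ G1).
    apply: close1.
      by apply: net_perm n2' => //; perm_by_count.
    move=> x; rewrite names_link_map => /mapP[y hy ->].
    case: eqP => _; first by left; rewrite eS1 !inE eqxx orbT.
    by right; apply/negP => /dis/(_ hy).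
  have n4 : extended_net ((map (rename c b) L2 ++ R1) ++ R) G.
    apply: close.
      by apply: net_perm n3 => //; perm_by_count.
    move=> x hx; left; rewrite eS -cat1s !names_cat !mem_cat.
    move: hx; rewrite names_cat mem_cat names_link_map => /orP[/mapP[y hy ->]|hx].
      by case: eqP => _; rewrite ?hb1 ?hy ?orbT.
    by rewrite (perm_mem (perm_names pL1)) names_cat mem_cat hx !orbT.
  by apply: net_perm n4 => //; perm_by_count.
- rewrite weight_rename (weight_perm pL0) /weight /=; clear; case: A => /= *; lia.
- by rewrite has_hole_map (perm_has _ pL0).
- move=> v; split=> -[e he hv].
    move: he; rewrite (experiment_perm _ pL0) => /experiment_cons[/= eab /experiment_cons[/= eac he]].
    exists e => //; apply/experiment_map.
    apply: eq_in_experiment he => x _ /=.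
    by case: eqP => // ->; rewrite -eac.
  (* Backwards, the two erased names [a] and [c] receive the label of [b]. *)
  exists (fun x => if x == a then e b else e (f x)).
    rewrite (experiment_perm _ pL0); apply/experiment_cons; split.
      by rewrite /= eqxx /f; case: eqP => // _; case: eqP.
    apply/experiment_cons; split.
      by rewrite /= eqxx eq_sym nac /f eqxx.
    move/experiment_map: he => he; apply: eq_in_experiment he => x hx /=.
    by case: (x =P a) => // xa; case/negP: na0; rewrite -xa.
  move=> x hx; rewrite /f; case: eqP => [xa|_]; first by case/negP: naG; rewrite -xa.
  case: eqP => [xc|_]; first by case/negP: ncG; rewrite -xc.
  exact: hv.
Qed.

(** * Normalisation *)

(** A ⅋ link at a conclusion can be permuted to the end of the derivation, so deleting it leaves a
    net. *)
Lemma net_par_inv L G a b c A B :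
  extended_net L (pos c (A ⊸ B) :: G) -> ParP a b c A B \in L ->
  exists2 M, perm_eq L (ParP a b c A B :: M)
           & extended_net M (neg a A :: pos b B :: G).
Proof.
move=> n hl.
have [|S [R [D [/= [M [D0 [nM eS pD]]] pL close]]]] :=
  net_focus_conclusion (o := pos c (A ⊸ B)) n hl isT; first by rewrite mem_head.
exists (M ++ R); first by rewrite eS in pL; perm_by_count.
apply: (close M [:: neg a A; pos b B]).
  by apply: net_perm nM => //; perm_by_count.
by move=> x hx; left; rewrite eS -cat1s names_cat mem_cat hx orbT.
Qed.

Lemma names_sub L L' x : {subset L <= L'} -> x \in names L -> x \in names L'.
Proof.
move=> sub /flattenP[s /mapP[l hl ->] hx]; apply/flattenP.
by exists (link_names l) => //; apply: map_f; apply: sub.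
Qed.

Lemma mem_names_cons x l L :
  (x \in names (l :: L)) = (x \in link_names l) || (x \in names L).
Proof. by rewrite /names /= mem_cat. Qed.

Lemma reduce_mult L G a b c a' b' c' A B :
  extended_net L G -> TensN a b c A B \in L -> ParP a' b' c' A B \in L ->
  Cut c' c (A ⊸ B) \in L ->
  exists L', reducible_to L L' G.
Proof.
move=> n hT hP hC; have w := net_wired n.
have [S [R [D [/= [L1 [L2 [G1 [G2 [n1 n2 dis eS pD]]]]] pL close]]]] := net_focus n hC.
move/disjoint_namesP: dis => dis.
have subL1 l : l \in L1 -> l \in L.
  by move=> h; rewrite (perm_mem pL) eS mem_cat inE mem_cat h orbT.
have subL2 l : l \in L2 -> l \in L.
  by move=> h; rewrite (perm_mem pL) eS mem_cat inE mem_cat h !orbT.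
have hP1 : ParP a' b' c' A B \in L1.
  have [|l hl hal] := @conclusion_link _ _ (pos c' (A ⊸ B)) (net_wired n1).
    by rewrite mem_cat mem_head orbT.
  suff -> : ParP a' b' c' A B = l by [].
  by apply: (conclusion_link_inj w hP (subL1 _ hl) _ hal erefl); rewrite mem_head.
have hT2 : TensN a b c A B \in L2.
  have [|l hl hal] := @conclusion_link _ _ (neg c (A ⊸ B)) (net_wired n2).
    by rewrite mem_cat mem_head orbT.
  suff -> : TensN a b c A B = l by [].
  by apply: (conclusion_link_inj w hT (subL2 _ hl) _ hal erefl); rewrite mem_head.
have [M pM nM] := net_par_inv n1 hP1.
have [|S2 [R2 [D2 [/= [M1 [M2 [E1 [E2 [m1 m2 dis2 eS2 pD2]]]]] pL2 close2]]]] :=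
  net_focus_conclusion (o := neg c (A ⊸ B)) n2 hT2 isT; first by rewrite mem_head.
move/disjoint_namesP: dis2 => dis2.
have inM x : x \in names M -> x \in names L1.
  by apply: names_sub => l hl; rewrite (perm_mem pM) inE hl orbT.
have inS2 x : x \in names S2 -> x \in names L2.
  by apply: names_sub => l hl; rewrite (perm_mem pL2) mem_cat hl.
have inM1 x : x \in names M1 -> x \in names S2.
  by apply: names_sub => l hl; rewrite eS2 inE mem_cat hl orbT.
have inM2 x : x \in names M2 -> x \in names S2.
  by apply: names_sub => l hl; rewrite eS2 inE mem_cat hl !orbT.
have aM1 : a \in names M1 by apply: (net_conclusion_name (o := pos a A) m1); rewrite mem_head.
have bM2 : b \in names M2 by apply: (net_conclusion_name (o := neg b B) m2); rewrite mem_head.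
have aM : a' \in names M by apply: (net_conclusion_name (o := neg a' A) nM); rewrite mem_head.
have bM : b' \in names M.
  by apply: (net_conclusion_name (o := pos b' B) nM); rewrite !inE eqxx orbT.
(* Both premises of the ⅋ belong to the single net [M], those of the ⊗ to two nets. Cutting [M] with
   [M1] and the result with [M2] keeps each cut between disjoint nets. *)
have k1 : extended_net (Cut a a' A :: M1 ++ M) (E1 ++ pos b' B :: G1).
  apply: net_cut m1 nM _; apply/disjoint_namesP => x h1 h2.
  by apply: (dis x); [apply: inM|apply/inS2/inM1].
have k1' : extended_net (Cut a a' A :: M1 ++ M) (pos b' B :: E1 ++ G1).
  by apply: net_perm k1 => //; perm_by_count.
have k2 : extended_net (Cut b' b B :: (Cut a a' A :: M1 ++ M) ++ M2) ((E1 ++ G1) ++ E2).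
  apply: net_cut k1' m2 _; apply/disjoint_namesP => x h1 h2.
  have xM : x \in names M -> False.
    by move=> h; apply: (dis x); [apply: inM|apply/inS2/inM2].
  have xM1 : x \in names M1 -> False by move=> h; apply: (dis2 x).
  move: h1; rewrite mem_names_cons names_cat mem_cat !inE -!orbA.
  by case/or4P=> [/eqP e|/eqP e|/xM1|/xM] //; [apply: xM1|apply: xM]; rewrite e.
set S' := _ :: _ ++ M2 in k2.
have inS' x : x \in names S' -> x \in names S2 \/ x \in names L1.
  rewrite /S' mem_names_cons names_cat mem_cat mem_names_cons names_cat mem_cat !inE -!orbA.
  move=> hx; repeat case/orP: hx => hx; try (move/eqP: hx => ->);
    first [by right; apply: inM|by left; apply: inM1|by left; apply: inM2].
have k3 : extended_net (S' ++ R2) (G1 ++ G2).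
  apply: close2.
    by apply: net_perm k2 => //; perm_by_count.
  move=> x /inS'[]; first by left.
  by move=> h; right; apply/negP => /(dis _ h).
have k4 : extended_net ((S' ++ R2) ++ R) G.
  apply: close; first by apply: net_perm k3 => //; perm_by_count.
  move=> x hx; left; rewrite eS -cat1s !names_cat !mem_cat.
  move: hx; rewrite names_cat mem_cat => /orP[/inS'[/inS2|]|hx]; try by move=> ->; rewrite !orbT.
  by rewrite (perm_mem (perm_names pL2)) names_cat mem_cat hx !orbT.
pose L0 := M1 ++ M ++ M2 ++ R2 ++ R.
have pL0 : perm_eq L [:: TensN a b c A B, ParP a' b' c' A B, Cut c' c (A ⊸ B) & L0].
  by rewrite eS in pL; rewrite eS2 in pL2; rewrite /L0; perm_by_count.
pose X := [:: TensN a b c A B; ParP a' b' c' A B; Cut c' c (A ⊸ B)].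
have [nc0 ncG] : c \notin names L0 /\ c \notin unzip1 G.
  by apply: (wired_private (X := X) w pL0); rewrite /X /prems /concls /= !inE eqxx ?orbT.
have [nc0' ncG'] : c' \notin names L0 /\ c' \notin unzip1 G.
  by apply: (wired_private (X := X) w pL0); rewrite /X /prems /concls /= !inE eqxx ?orbT.
have uX : uniq [:: a; b; a'; b'; c'; c].
  have := wired_uniq_conclusions w; rewrite /unzip1 map_cat cat_uniq => /and3P[u _ _].
  move: u; rewrite (perm_uniq (perm_map fst (perm_prems pL0))).
  have -> : prems [:: TensN a b c A B, ParP a' b' c' A B, Cut c' c (A ⊸ B) & L0] = prems X ++ prems L0 by [].
  by rewrite map_cat cat_uniq => /and3P[].
exists [:: Cut a a' A, Cut b' b B & L0]; split.
- exact: step_mult pL0.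
- by apply: net_perm k4 => //; rewrite /S' /L0; perm_by_count.
- by rewrite (weight_perm pL0) /weight /=; clear; lia.
- by rewrite (perm_has _ pL0).
- move=> v; split=> -[e he hv].
    move: he; rewrite (experiment_perm _ pL0) => /experiment_cons[/= e1
      /experiment_cons[/= e2 /experiment_cons[/= e3 he]]].
    have [ea eb] : e a = e a' /\ e b = e b' by apply: pair_inj; rewrite -e1 -e2.
    by exists e => //; apply/experiment_cons; split=> //; apply/experiment_cons.
  case/experiment_cons: he => /= ea /experiment_cons[/= eb he].
  (* The erased names get the only label that the restored links permit. *)
  pose e' x := if (x == c) || (x == c') then pair (e a) (e b) else e x.
  have e'E x : x \in [:: a; b; a'; b'] -> e' x = e x.
    move: uX; rewrite -[[:: a; _; _; _; _; _]]/([:: a; b; a'; b'] ++ [:: c'; c]) cat_uniq.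
    case/and3P=> _ /norP[hc' /norP[hc _]] _ hx; rewrite /e'.
    case: eqP => [xc|_]; first by case/negP: hc; rewrite -xc.
    by case: eqP => [xc|_] //; case/negP: hc'; rewrite -xc.
  have [ec ec'] : e' c = pair (e a) (e b) /\ e' c' = pair (e a) (e b).
    by rewrite /e' !eqxx orbT.
  exists e'.
    rewrite (experiment_perm _ pL0); apply/experiment_cons; split.
      by rewrite /= ec !e'E // !inE eqxx ?orbT.
    apply/experiment_cons; split.
      by rewrite /= ec' ea -eb !e'E // !inE eqxx ?orbT.
    apply/experiment_cons; split; first by rewrite /= ec ec'.
    apply: eq_in_experiment he => x hx; rewrite /e'.
    case: eqP => [xc|_]; first by case/negP: nc0; rewrite -xc.
    by case: eqP => [xc|_] //; case/negP: nc0'; rewrite -xc.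
  move=> x hx; rewrite /e'.
  case: eqP => [xc|_]; first by case/negP: ncG; rewrite -xc.
  by case: eqP => [xc|_]; [case/negP: ncG'; rewrite -xc|exact: hv].
Qed.

Lemma fresh_bound (s : seq nat) : exists n, forall x, x \in s -> x < n.
Proof.
exists (foldr maxn 0 s).+1; elim: s => //= y s IH x.
by rewrite inE => /orP[/eqP->|/IH]; lia.
Qed.

Lemma reduce_eta L G c d A B :
  extended_net L G -> Id c d (A ⊸ B) \in L -> exists L', reducible_to L L' G.
Proof.
move=> n hI; have [m hm] := fresh_bound (names L).
have [S [R [D [/= [ncd eS pD] pL close]]]] := net_focus n hI.
have pL0 : perm_eq L (Id c d (A ⊸ B) :: R) by rewrite eS in pL.
have [hc hd] : c < m /\ d < m.
  by split; apply: hm; rewrite (perm_mem (perm_names pL0)) !inE eqxx ?orbT.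
have mE k x : x < m -> (m + k == x) = false by clear; lia.
have mN k : (m + k \in names L) = false.
  by apply/negP => /hm; clear; lia.
pose a := m; pose a' := m + 1; pose b := m + 2; pose b' := m + 3.
have ua : uniq [:: a; a'; b; b'] by rewrite /= !inE /a /a' /b /b'; clear; lia.
have fa : ~~ has (mem (names L)) [:: a; a'; b; b'].
  by rewrite /= /a -{1}[m]addn0 !mN.
exists [:: Id a a' A, Id b b' B, ParP a' b c A B, TensN a b' d A B & R]; split.
- exact: step_eta pL0 ua fa.
- have k1 : extended_net [:: TensN a b' d A B; Id a a' A; Id b b' B]
      ([:: neg d (A ⊸ B)] ++ [:: neg a' A] ++ [:: pos b B]).
    apply: (@net_tens [:: Id a a' A] [:: Id b b' B]).
    + by apply: net_id; rewrite /a /a'; clear; lia.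
    + apply: (@net_perm [:: Id b b' B] _ [:: pos b B; neg b' B]); try perm_by_count.
      by apply: net_id; rewrite /b /b'; clear; lia.
    + by rewrite /disjoint_names /= !inE /a /a' /b /b'; clear; lia.
    + by rewrite /= !inE /a /a' /b /b'; move: hd; clear; lia.
  have k2 : extended_net [:: ParP a' b c A B; TensN a b' d A B; Id a a' A; Id b b' B]
      [:: pos c (A ⊸ B); neg d (A ⊸ B)].
    apply: net_par.
      by apply: net_perm k1 => //; perm_by_count.
    by rewrite /= !inE (negbTE ncd) /a /a' /b /b'; move: hc; clear; lia.
  apply: net_perm (close _ _ _); last 2 first.
  + by apply: net_perm k2 => //; perm_by_count.
  + move=> x; rewrite eS -[names _]/[:: a'; b; c; a; b'; d; a; a'; b; b'] => hx.
    have : (x \in [:: c; d]) || (x \in [:: a; a'; b; b']).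
      by move: hx; rewrite !inE; do !case: eqP => _ //=.
    case/orP=> [|xa]; [by left|right].
    by apply/negP => xL; case/negP: fa; apply/hasP; exists x.
  + by perm_by_count.
  + by [].
- by rewrite (weight_perm pL0) /weight /=; clear; lia.
- by rewrite (perm_has _ pL0).
- move=> v; split=> -[e he hv].
    move: he; rewrite (experiment_perm _ pL0) => /experiment_cons[/= ecd he].
    (* Surjectivity of the pairing matters here: whatever the label of the axiom, it splits into
       labels for the two smaller axioms. *)
    have [p [q epq]] := pair_surj (e c).
    pose e' x := if x < m then e x else if (x == a) || (x == a') then p else q.
    have e'E x : x < m -> e' x = e x by rewrite /e' => ->.
    have ea : e' a = p by rewrite /e' ltnn eqxx.
    have ea' : e' a' = p by rewrite /e' ltnNge leq_addr eqxx orbT.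
    have eb : e' b = q.
      rewrite /e' ltnNge leq_addr; suff -> : (b == a) || (b == a') = false by [].
      by rewrite /b /a /a'; clear; lia.
    have eb' : e' b' = q.
      rewrite /e' ltnNge leq_addr; suff -> : (b' == a) || (b' == a') = false by [].
      by rewrite /b' /a /a'; clear; lia.
    exists e'.
      do 4 (apply/experiment_cons; split; first by rewrite /= ?ea ?ea' ?eb ?eb' ?e'E -?ecd).
      apply: eq_in_experiment he => x hx; rewrite e'E //; apply: hm.
      by rewrite (perm_mem (perm_names pL0)) !inE hx !orbT.
    move=> x hx; rewrite e'E ?hv //; apply: hm.
    by case/mapP: hx => o ho ->; apply: net_conclusion_name ho.
  case/experiment_cons: he => /= ea /experiment_cons[/= eb /experiment_cons[/= ec /experiment_cons[/= ed he]]].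
  exists e => //; rewrite (experiment_perm _ pL0); apply/experiment_cons; split=> //=.
  by rewrite ec ed ea eb.
Qed.

Definition normal_link (l : link) : bool :=
  match l with
  | Id _ _ A => A == Atom
  | Cut _ _ _ | Hole _ _ => false
  | _ => true
  end.

Lemma normal_links_normal L : all normal_link L -> is_normal L.
Proof.
move=> /allP h L' [] => [a b c A L0 p|a b c A L0 p|a b c a' b' c' A B L0 p|c d a a' b b' A B L0 p _ _].
- by have := h (Cut a c A); rewrite (perm_mem p) !inE eqxx !orbT => /(_ isT).
- by have := h (Cut c b A); rewrite (perm_mem p) !inE eqxx !orbT => /(_ isT).
- by have := h (Cut c' c (A ⊸ B)); rewrite (perm_mem p) !inE eqxx !orbT => /(_ isT).
- by have := h (Id c d (A ⊸ B)); rewrite (perm_mem p) !inE eqxx => /(_ isT).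
Qed.

(** Axioms are expanded first. Once all are atomic, the positive premise of a cut on [Atom] comes
    from an axiom, and the premises of any other cut come from a ⅋ and a ⊗ link. *)
Lemma net_progress L G :
  extended_net L G -> ~~ has is_hole L ->
  all normal_link L \/ exists L', reducible_to L L' G.
Proof.
move=> n nh; have [|] := boolP (all normal_link L); first by left.
move/allPn => [l hl nl]; right; have w := net_wired n.
have [[c [d [A [B h]]]]|neta] :
  (exists c d A B, Id c d (A ⊸ B) \in L) \/ (forall c d A B, Id c d (A ⊸ B) \notin L).
  have [/hasP[[]]|/hasPn no] := boolP (has (fun l => if l is Id _ _ (_ ⊸ _) then true else false) L) => //.
    by move=> c d [|A B] // h _; left; exists c, d, A, B.
  by right=> c d A B; apply/negP => /no.
  by apply: reduce_eta n h.
case: l hl nl => [c d [|A B]|a c A|||a A] hl // _.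
- by case/negP: (neta c d A B).
- have [|l1 h1 hc1] := @conclusion_link _ _ (pos a A) w.
    by rewrite mem_cat; apply/orP; left; apply/premisesP; exists (Cut a c A) => //; rewrite mem_head.
  have [|l2 h2 hc2] := @conclusion_link _ _ (neg c A) w.
    by rewrite mem_cat; apply/orP; left; apply/premisesP; exists (Cut a c A) => //; rewrite !inE eqxx orbT.
  case: l1 h1 hc1 => [a1 b1 A1|? ? ?|? ? ? ? ?|a' b' c' A1 B1|a1 A1] h1.
  + rewrite !inE => /orP[] /eqP[] // ? ?; subst a1 A1; exact: reduce_axiom n h1 hl.
  + by [].
  + by rewrite inE => /eqP.
  + rewrite inE => /eqP[? ?]; subst a A.
    case: l2 h2 hc2 => [a2 b2 A2|? ? ?|a2 b2 c2 A2 B2|? ? ? ? ?|? ?] h2.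
    * rewrite !inE => /orP[] /eqP[] // ? ?; subst; by case/negP: (neta a2 b2 A1 B1).
    * by [].
    * by rewrite inE => /eqP[? ? ?]; subst; apply: reduce_mult n h2 h1 hl.
    * by rewrite inE => /eqP.
    * by rewrite inE => /eqP.
  + by move=> _; case/hasP: nh; exists (Hole a1 A1).
- by case/hasP: nh; exists (Hole a A).
Qed.

Lemma net_normalisation L G :
  extended_net L G -> ~~ has is_hole L ->
  exists N, [/\ clos_refl_trans _ step L N, extended_net N G, all normal_link N
              & same_experiments L N G].
Proof.
have [k] := ubnP (weight L); elim: k L => // k IH L hk n nh.
have [hN|[L' [st n' wL hh se]]] := net_progress n nh.
  by exists L; split=> //; apply: rt_refl.
have [||N [r nN hN se']] := IH L' _ n'; first by move: hk wL; clear; lia.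
  by rewrite hh.
exists N; split=> //; first by apply: rt_trans r; apply: rt_step.
by move=> v; rewrite se.
Qed.

(** * Terms of normal nets *)

Inductive term := Var of nat | App of term & term.

Fixpoint vars (s : term) : seq nat :=
  match s with Var i => [:: i] | App s t => vars s ++ vars t end.

Fixpoint tbind (f : nat -> term) (s : term) : term :=
  match s with Var i => f i | App s t => App (tbind f s) (tbind f t) end.

Definition trename (f : nat -> nat) : term -> term := tbind (Var \o f).

(** Application in the relational model: the label of a function pairs the one argument it accepts
    with its result, so evaluation may fail. *)
Fixpoint evals (v : nat -> nat) (s : term) (w : nat) : Prop :=
  match s with
  | Var i => v i = w
  | App s t => exists2 u, evals v t u & evals v s (pair u w)
  end.

(** [m] counts the arguments still missing; arguments themselves must be saturated, as in
    first-order terms. *)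
Fixpoint has_arity (ar : nat -> nat) (s : term) (m : nat) : Prop :=
  match s with
  | Var i => ar i = m
  | App s t => has_arity ar s m.+1 /\ has_arity ar t 0
  end.

Lemma evals_fun v s w w' : evals v s w -> evals v s w' -> w = w'.
Proof.
elim: s w w' => [i|s IHs t IHt] w w' /=; first by move=> ->.
case=> u ht hs [u' ht' hs'].
by have [_] := pair_inj (IHs _ _ hs hs').
Qed.

Lemma evals_trename v f s w : evals v (trename f s) w <-> evals (v \o f) s w.
Proof.
elim: s w => [i|s IHs t IHt] w //=.
by split=> -[u /IHt ht /IHs hs]; exists u.
Qed.

Lemma eq_in_evals v v' s w : {in vars s, v =1 v'} -> evals v s w -> evals v' s w.
Proof.
elim: s w => [i|s IHs t IHt] w /= h; first by rewrite -h ?mem_head.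
case=> u ht hs; exists u; [apply: IHt ht|apply: IHs hs] => x hx; apply: h;
by rewrite mem_cat hx ?orbT.
Qed.

Lemma evals_tbind_var v f s w i :
  i \in vars s -> evals v (tbind f s) w -> exists w', evals v (f i) w'.
Proof.
elim: s w => [j|s IHs t IHt] w /=; first by rewrite inE => /eqP-> h; exists w.
by rewrite mem_cat => /orP[/IHs h|/IHt h] [u ht hs]; [apply: h hs|apply: h ht].
Qed.

Lemma evals_tbind v v' f s w :
  {in vars s, forall i, evals v (f i) (v' i)} -> evals v (tbind f s) w -> evals v' s w.
Proof.
elim: s w => [j|s IHs t IHt] w /= h.
  by apply: evals_fun; apply: h; rewrite mem_head.
case=> u ht hs; exists u; [apply: IHt ht|apply: IHs hs] => x hx; apply: h;
by rewrite mem_cat hx ?orbT.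
Qed.

Lemma has_arity_tbind ar ar' f s m :
  {in vars s, forall i, has_arity ar (f i) (ar' i)} ->
  has_arity ar' s m -> has_arity ar (tbind f s) m.
Proof.
elim: s m => [j|s IHs t IHt] m /= h; first by move=> <-; apply: h; rewrite mem_head.
by case=> hs ht; split; [apply: IHs hs|apply: IHt ht] => x hx; apply: h;
  rewrite mem_cat hx ?orbT.
Qed.

Lemma vars_tbind f s : vars (tbind f s) = flatten [seq vars (f i) | i <- vars s].
Proof. by elim: s => [i|s IHs t IHt] /=; rewrite ?cats0 // map_cat flatten_cat IHs IHt. Qed.

Lemma vars_trename f s : vars (trename f s) = map f (vars s).
Proof. by elim: s => [i|s IHs t IHt] //=; rewrite map_cat IHs IHt. Qed.

Lemma trename_comp_id f g s :
  {in vars s, forall i, f (g i) = i} -> trename f (trename g s) = s.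
Proof.
elim: s => [i|s IHs t IHt] /= h; first by rewrite /trename /= h ?mem_head.
rewrite -[LHS]/(App (trename f (trename g s)) (trename f (trename g t))).
by rewrite IHs ?IHt // => x hx; apply: h;
  rewrite mem_cat hx ?orbT.
Qed.

(* The term denoted by a negative occurrence: from it, the main path goes down
   through ⊗^- links, i.e. applications. Arguments are restricted to atomic
   occurrences, which suffices when all heads have order at most 2. *)
Inductive neutral (L : seq link) : nat -> term -> Prop :=
| neutral_var z : neutral L z (Var z)
| neutral_app a b c A B z s t :
    TensN a b c A B \in L -> Id a z Atom \in L ->
    neutral L z t -> neutral L c s -> neutral L b (App s t).

Lemma neutral_varI L z i : neutral L z (Var i) -> z = i.
Proof. by move=> h; inversion h. Qed.

Lemma neutral_appI L b s t : neutral L b (App s t) ->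
  exists a c A B z, [/\ TensN a b c A B \in L, Id a z Atom \in L,
                        neutral L z t & neutral L c s].
Proof. by move=> h; inversion h; subst; exists a, c, A, B, z. Qed.

Lemma neutral_sub L L' z s : {subset L <= L'} -> neutral L z s -> neutral L' z s.
Proof.
move=> sub; elim=> [x|a b c A B x s' t h1 h2 _ IH1 _ IH2]; first exact: neutral_var.
exact: neutral_app (sub _ h1) (sub _ h2) IH1 IH2.
Qed.

Lemma neutral_tbind L f z s :
  (forall x, neutral L x (f x)) -> neutral L z s -> neutral L z (tbind f s).
Proof.
move=> hf; elim=> [x|a b c A B x s' t h1 h2 _ IH1 _ IH2]; first exact: hf.
exact: neutral_app h1 h2 IH1 IH2.
Qed.

Lemma neutral_evals L e z s : experiment e L -> neutral L z s -> evals e s (e z).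
Proof.
move=> he; elim=> [x|a b c A B x s' t h1 h2 _ IH1 _ IH2] //=.
by exists (e a); [rewrite (he _ h2)|rewrite -(he _ h1)].
Qed.

Lemma main_up_experiment L e x xs y :
  experiment e L -> main_up L x xs y -> e x = foldr pair (e y) (map e xs).
Proof. by move=> he; elim=> [|a b c A B us z h _ IH] //=; rewrite -IH (he _ h). Qed.

Lemma main_up_sub L L' x xs y :
  {subset L <= L'} -> main_up L x xs y -> main_up L' x xs y.
Proof.
move=> sub; elim=> [z|a b c A B us z h _ IH]; first exact: up_nil.
exact: up_cons (sub _ h) IH.
Qed.

Lemma main_up_premise L x xs y h :
  main_up L x xs y -> h \in xs -> exists b c A B, ParP h b c A B \in L.
Proof.
elim=> [|a b c A B us z hl _ IH] //; rewrite inE => /orP[/eqP->|/IH //].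
by exists b, c, A, B.
Qed.

Lemma premise_link_inj L G l l' o o' :
  wired L G -> l \in L -> l' \in L -> o \in premises l -> o' \in premises l' ->
  o.1 = o'.1 -> l = l'.
Proof.
move=> w hl hl' ho ho' eo; apply/eqP/negPn/negP => ne.
have pl := perm_to_rem hl.
have hr : l' \in rem l L.
  by move: hl'; rewrite (perm_mem pl) inE eq_sym (negbTE ne).
have := wired_uniq_conclusions w; rewrite /unzip1 map_cat cat_uniq => /and3P[u _ _].
move: u; rewrite (perm_uniq (perm_map fst (perm_prems pl))) /=.
rewrite /prems /= map_cat cat_uniq => /and3P[_ /hasPn h _].
have /h/negP : o'.1 \in unzip1 (prems (rem l L)).
  by apply: map_f; apply/premisesP; exists l'.
by apply; rewrite -eo; apply: map_f.
Qed.

(** The intuitionistic invariant: a binary rule consumes the positive conclusion of one of its two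
    nets, and the ⅋ rule replaces one by another. *)
Lemma one_positive_conclusion L G :
  extended_net L G -> count (fun o : occurrence => o.2.1) G = 1.
Proof.
elim=> {L G} [//|//|L1 L2 G1 G2 a b A _ /= h1 _ /= h2 _|L1 L2 G1 G2 a b c A B _ /= h1 _ /= h2 _ _
  |L G a b c A B _ /= h _|L L' G G' _ pG _ <-]; rewrite ?count_cat /= ?count_cat.
- by move: h1 h2; clear; lia.
- by move: h1 h2; clear; lia.
- by move: h; clear; lia.
- by move/permP: pG.
Qed.

Fixpoint arity (A : formula) : nat := if A is _ ⊸ B then (arity B).+1 else 0.

Definition low (o : occurrence) : bool :=
  if o.2.1 then o.2.2 == Atom else formula_order o.2.2 <= 2.

Lemma formula_order_gt0 A : 0 < formula_order A.
Proof. by case: A => //= A B; rewrite leq_max ltnS orbC; case: formula_order. Qed.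

Lemma order2_limp A B : formula_order (A ⊸ B) <= 2 -> A = Atom /\ formula_order B <= 2.
Proof.
rewrite /= geq_max ltnS => /andP[h hB]; split=> //.
by case: A h => //= A1 A2; rewrite geq_max ltnNge formula_order_gt0.
Qed.

(** Neither cut nor ⅋ occurs: the former is not normal, the latter yields a positive conclusion that
    is not atomic. A ⊗ link substitutes an application for a variable, and every clause is stable
    under this. The last clause is a converse of [neutral_evals]: each value of the term comes from
    an experiment. *)
Lemma normal_net_term L G :
  extended_net L G -> all normal_link L -> all low G ->
  exists y z G0 s,
    [/\ perm_eq G (pos y Atom :: G0), Id y z Atom \in L /\ neutral L z s,
        perm_eq (vars s) (unzip1 G0),
        forall ar, {in G0, forall o, ar o.1 = arity o.2.2} -> has_arity ar s 0
      & forall v w, evals v s w -> exists e,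
          [/\ experiment e L, {in unzip1 G0, e =1 v} & e y = w]].
Proof.
elim=> {L G} [a b A nab|//|//|L1 L2 G1 G2 a b c A B n1 IH1 n2 IH2 dis nc|L G a b c A B|
  L L' G G' pL pG _ IH].
- rewrite /= andbT => /eqP-> _; exists a, b, [:: neg b Atom], (Var b); split=> //.
  + by rewrite mem_head; split=> //; exact: neutral_var.
  + by move=> ar /(_ _ (mem_head _ _)).
  + move=> v w /= <-; exists (fun _ => v b); split=> //.
      by move=> l; rewrite inE => /eqP->.
    by move=> x; rewrite inE => /eqP->.
- rewrite /= all_cat => /andP[N1 N2] /andP[/order2_limp[eA hB]]; subst A.
  rewrite all_cat => /andP[low1 low2].
  have [] := IH1 N1; first by rewrite /= low1.
  move=> y1 [z1 [E1 [t [p1 [i1 u1] v1 a1 x1]]]].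
  have [] := IH2 N2; first by rewrite /= low2 /low /= hB.
  move=> y [z [E2 [s [p2 [i2 u2] v2 a2 x2]]]] {IH1 IH2}.
  (* The only positive conclusion of the first net is [a], so its axiom must start there. *)
  have c1 : count (fun o : occurrence => o.2.1) G1 = 0.
    by have /= := one_positive_conclusion n1; clear; lia.
  have ey1 : y1 = a.
    have : pos y1 Atom \in pos a Atom :: G1 by rewrite (perm_mem p1) mem_head.
    rewrite inE => /orP[/eqP[]//|h].
    by move/eqP: c1; rewrite -leqn0 leqNgt -has_count => /hasPn /(_ _ h).
  subst y1; have q1 : perm_eq G1 E1 by move: p1; rewrite perm_cons.
  have bE2 : neg b B \in E2.
    have : neg b B \in pos y Atom :: E2 by rewrite -(perm_mem p2) mem_head.
    by rewrite inE => /orP[/eqP|].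
  have pE2 := perm_to_rem bE2; set E3 := rem _ _ in pE2.
  have w2 := net_wired n2.
  have uE2 : uniq (b :: unzip1 E3).
    have := wired_uniq_conclusions w2; rewrite /unzip1 map_cat cat_uniq => /and3P[_ _].
    rewrite (perm_uniq (perm_map fst p2)) /= => /andP[_].
    by rewrite (perm_uniq (perm_map fst pE2)).
  have pvs : perm_eq (vars s) (b :: unzip1 E3).
    by apply: perm_trans v2 _; apply: (perm_map fst pE2).
  (* Through the new link, [b] denotes the variable [c] applied to the argument [t]. *)
  pose q := App (Var c) t.
  pose f x := if x == b then q else Var x.
  pose L := TensN a b c Atom B :: L1 ++ L2.
  have sub1 : {subset L1 <= L} by move=> l h; rewrite inE mem_cat h orbT.
  have sub2 : {subset L2 <= L} by move=> l h; rewrite inE mem_cat h !orbT.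
  exists y, z, (neg c (Atom ⊸ B) :: E1 ++ E3), (tbind f s); split.
  + by perm_by_count.
  + split; first exact: sub2.
    apply: neutral_tbind; last exact: neutral_sub u2.
    move=> x; rewrite /f; case: eqP => [->|_]; last exact: neutral_var.
    apply: (@neutral_app L a b c Atom B z1).
    * by rewrite mem_head.
    * exact: sub1.
    * exact: neutral_sub u1.
    * exact: neutral_var.
  + rewrite vars_tbind.
    have pf : perm_eq (flatten [seq vars (f i) | i <- vars s])
                      (flatten [seq vars (f i) | i <- b :: unzip1 E3]).
      by apply: perm_flatten; apply: perm_map.
    apply: perm_trans pf _; rewrite /= {1}/f eqxx /=.
    have -> : flatten [seq vars (f i) | i <- unzip1 E3] = unzip1 E3.
      rewrite -[RHS]flatten_seq1; congr flatten; apply/eq_in_map => i hi.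
      rewrite /f; case: eqP => // e; case/andP: uE2 => /negP[]; by rewrite -e.
    by rewrite /= perm_cons /unzip1 map_cat perm_cat2r.
  + move=> ar har.
    have arc : ar c = (arity B).+1 by apply: (har (neg c (Atom ⊸ B))); rewrite mem_head.
    apply: (@has_arity_tbind _ (fun x => if x == b then arity B else ar x)).
      move=> i _; rewrite /f; case: eqP => //= _; split=> //.
      by apply: a1 => o ho; apply: har; rewrite inE mem_cat ho orbT.
    apply: a2 => o; rewrite (perm_mem pE2) inE => /orP[/eqP->|ho]; first by rewrite /= eqxx.
    case: eqP => [e|_]; first by case/andP: uE2 => /negP[]; rewrite -e; apply: mem_unzip1 ho.
    by apply: har; rewrite inE mem_cat ho !orbT.
  + move=> v w hev.
    have bs : b \in vars s by rewrite (perm_mem pvs) mem_head.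
    (* The value that [q] takes within the whole term becomes the label of [b]; evaluation then
       splits into one of [t] and one of [s]. *)
    have [w'] := evals_tbind_var bs hev; rewrite /f eqxx /= => -[u ht hc].
    have {}hev : evals (fun x => if x == b then w' else v x) s w.
      apply: evals_tbind hev => i _; rewrite /f; case: eqP => //= _.
      by exists u.
    have [e1 [ex1 ev1 ea]] := x1 _ _ ht.
    have [e2 [ex2 ev2 ey]] := x2 _ _ hev.
    have eb : e2 b = w'.
      by rewrite ev2 ?eqxx // (perm_mem (perm_map fst pE2)) mem_head.
    have aL : a \in names L1 by apply: (net_conclusion_name (o := pos a Atom) n1); rewrite mem_head.
    have inL2 o : o \in neg b B :: G2 -> o.1 \in names L2 by apply: net_conclusion_name.
    have bL : b \in names L2 by apply: (inL2 (neg b B)); rewrite mem_head.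
    have yL : y \in names L2 by apply: (inL2 (pos y Atom)); rewrite (perm_mem p2) mem_head.
    move: nc; rewrite names_cat mem_cat negb_or => /andP[nc1 nc2].
    move/disjoint_namesP: dis => dis.
    pose e x := if x == c then pair u w' else if x \in names L1 then e1 x else e2 x.
    have eL1 x : x \in names L1 -> e x = e1 x.
      by move=> hx; rewrite /e hx; case: eqP => // xc; case/negP: nc1; rewrite -xc.
    have eL2 x : x \in names L2 -> e x = e2 x.
      move=> hx; rewrite /e; case: eqP => [xc|_]; first by case/negP: nc2; rewrite -xc.
      by case: ifP => // h; case: (dis x).
    exists e; split.
    * apply/experiment_cons; split.
        by rewrite /= (eL1 a) // (eL2 b) // ea eb /e eqxx.
      apply/experiment_cat; split; apply: eq_in_experiment; [|exact: ex1| |exact: ex2].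
        by move=> x hx; rewrite eL1.
      by move=> x hx; rewrite eL2.
    * move=> x; rewrite /= inE /unzip1 map_cat mem_cat => /or3P[/eqP->|hx|hx].
      - by rewrite /e eqxx hc.
      - rewrite eL1 ?ev1 //; case/mapP: hx => o ho ->.
        by apply: (net_conclusion_name n1); rewrite inE (perm_mem q1) ho orbT.
      - have hx2 : x \in unzip1 E2.
          by rewrite /unzip1 (perm_mem (perm_map fst pE2)) inE hx orbT.
        rewrite eL2 ?ev2 //; last first.
          case/mapP: hx2 => o ho ->; apply: inL2; by rewrite (perm_mem p2) inE ho orbT.
        case: eqP => // xb; by case/andP: uE2 => /negP[]; rewrite -xb.
    * by rewrite eL2.
- by move=> _ _ _ _; rewrite /= /low.
- move=> nL lG; rewrite (perm_all _ (_ : perm_eq L' L)) in nL; last by rewrite perm_sym.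
  have [|y [z [E [s [h1 [h2 h2'] h3 h4 h5]]]]] := IH nL; first by rewrite (perm_all _ pG).
  exists y, z, E, s; split=> //.
  + by perm_by_count.
  + split; first by rewrite -(perm_mem pL).
    by apply: neutral_sub h2' => l; rewrite (perm_mem pL).
  + move=> v w /h5[e [e1 e2 e3]]; exists e; split=> //.
    by apply/(experiment_perm _ pL).
Qed.

(** * Closed normal nets of order 3 *)

Fixpoint args (A : formula) : seq formula :=
  if A is A1 ⊸ A2 then A1 :: args A2 else [::].

Definition negs (xs : seq nat) (As : seq formula) : seq occurrence :=
  [seq neg p.1 p.2 | p <- zip xs As].

Lemma unzip1_negs xs As : size xs = size As -> unzip1 (negs xs As) = xs.
Proof.
move=> h; rewrite /negs /unzip1 -map_comp -[RHS](@unzip1_zip _ _ xs As) ?h //.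
Qed.

(** All axioms being atomic, each positive implication is the conclusion of a ⅋ link, and these
    links can be stripped. Their labels are determined by their premises, so experiments of the body
    extend to the net. *)
Lemma normal_net_open L A x G :
  extended_net L (pos x A :: G) -> all normal_link L ->
  exists xs y M,
    [/\ main_up L x xs y, size xs = size (args A),
        extended_net M (pos y Atom :: negs xs (args A) ++ G), {subset M <= L}
      & forall e, experiment e M ->
          exists2 e', experiment e' L & {in names M, e' =1 e}].
Proof.
elim: A L x G => [|A1 _ A2 IH] L x G n nL.
  exists [::], x, L; split=> //; first exact: up_nil.
  by move=> e he; exists e.
have w := net_wired n.
have [|l hl hal] := @conclusion_link _ _ (pos x (A1 ⊸ A2)) w.
  by rewrite mem_cat mem_head orbT.
have nl := allP nL _ hl.
case: l hl hal nl => [c d [|? ?]|? ? ?|? ? ? ? ?|a b c B1 B2|? ?] hl hal // _.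
- by move: hal; rewrite !inE => /orP[/eqP[]|/eqP[]].
- by move: hal; rewrite inE => /eqP.
move: hal; rewrite inE => /eqP[? ? ?]; subst c B1 B2.
have [M0 pM n0] := net_par_inv n hl.
have subM : {subset M0 <= L} by move=> l h; rewrite (perm_mem pM) inE h orbT.
have n1 : extended_net M0 (pos b A2 :: neg a A1 :: G) by apply: net_perm n0 => //; perm_by_count.
have [|xs [y [M [up sz nM sub ext]]]] := IH _ _ _ n1.
  by apply/allP => l /subM; apply: (allP nL).
exists (a :: xs), y, M; split.
- by apply: up_cons hl _; apply: main_up_sub up.
- by rewrite /= sz.
- by apply: net_perm nM => //; rewrite /negs /=; perm_by_count.
- by move=> l /sub/subM.
move=> e he; have [e' he' eq'] := ext e he.
have nx : x \notin names M0.
  rewrite (mem_names_concls _ (net_wired n0)).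
  case: w => _; rewrite (perm_uniq (perm_map fst (perm_concls pM))).
  by rewrite /concls /= => /andP[].
have aM : a \in names M0 by apply: (net_conclusion_name (o := neg a A1) n0); rewrite mem_head.
have bM : b \in names M0.
  by apply: (net_conclusion_name (o := pos b A2) n0); rewrite !inE eqxx orbT.
pose e2 z := if z == x then pair (e' a) (e' b) else e' z.
have e2E z : z \in names M0 -> e2 z = e' z.
  by move=> hz; rewrite /e2; case: eqP => // zx; case/negP: nx; rewrite -zx.
exists e2.
  rewrite (experiment_perm _ pM); apply/experiment_cons; split.
    by rewrite /= (e2E a) // (e2E b) // /e2 eqxx.
  by apply: eq_in_experiment he' => z hz; rewrite e2E.
by move=> z hz; rewrite e2E ?eq' //; apply: names_sub hz.
Qed.

Lemma order3_args A : formula_order A < 4 -> all (fun B => formula_order B <= 2) (args A).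
Proof.
elim: A => //= A _ B IH; rewrite ltnS geq_max ltnS => /andP[-> /=].
by rewrite -ltnS; exact: IH.
Qed.

(** Variables are numbered by the position of their abstraction, which makes the terms of different
    nets comparable. The last clause says that main paths stop at abstracted occurrences, as
    [down_nil] demands of a head. *)
Definition represents (N : seq link) (x n : nat) (s : term) : Prop :=
  exists xs y z,
    [/\ main_up N x xs y, size xs = n, Id y z Atom \in N,
        neutral N z (trename (nth 0 xs) s)
      & forall h a c A B, h \in xs -> TensN a h c A B \notin N].

Definition arg_arity (A : formula) (i : nat) : nat := arity (nth Atom (args A) i).

Lemma closed_normal_net_term N x A :
  extended_net N [:: pos x A] -> all normal_link N -> formula_order A < 4 ->
  exists s,
    [/\ represents N x (size (args A)) s,
        perm_eq (vars s) (iota 0 (size (args A))),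
        has_arity (arg_arity A) s 0
      & forall v w, evals v s w ->
          exists2 e, experiment e N
                   & e x = foldr pair w (map v (iota 0 (size (args A))))].
Proof.
move=> n nN ordA; have w := net_wired n.
have [xs [y0 [M [up sz nM sub ext]]]] := normal_net_open n nN.
rewrite cats0 in nM.
have [||y [z [G0 [s [p [hI hs] vs ars exs]]]]] := normal_net_term nM.
- by apply/allP => l /sub; apply: (allP nN).
- rewrite /= /negs all_map; apply/allP => -[a B] hB /=.
  have := allP (order3_args ordA) B; rewrite /low /=; apply.
  by rewrite -[args A](@unzip2_zip _ _ xs) ?sz // (map_f snd hB).
have [ey pG] : y = y0 /\ perm_eq G0 (negs xs (args A)).
  have : pos y Atom \in pos y0 Atom :: negs xs (args A) by rewrite (perm_mem p) mem_head.
  rewrite inE => /orP[/eqP[e]|/mapP[] //]; split=> //.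
  by rewrite perm_sym; move: p; rewrite e perm_cons.
subst y0.
have pG1 : perm_eq (unzip1 G0) xs.
  by rewrite -[X in perm_eq _ X](unzip1_negs sz); apply: perm_map.
have uxs : uniq xs.
  have := wired_uniq_conclusions (net_wired nM); rewrite /unzip1 map_cat cat_uniq.
  by move=> /and3P[_ _ /=]; rewrite -/(unzip1 _) unzip1_negs // => /andP[].
have pvs : perm_eq (vars s) xs by apply: perm_trans pG1.
have sE : trename (nth 0 xs) (trename (index^~ xs) s) = s.
  by apply: trename_comp_id => i; rewrite (perm_mem pvs) => hi; rewrite nth_index.
have idx : map (index^~ xs) xs = iota 0 (size xs).
  apply: (@eq_from_nth _ 0); rewrite !size_map ?size_iota // => i hi.
  by rewrite (nth_map 0) // nth_iota // index_uniq.
exists (trename (index^~ xs) s); split.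
- exists xs, y, z; split=> //; first exact: sub.
    by rewrite sE; apply: neutral_sub hs.
  move=> h a c B C hx; apply/negP => hT.
  have [b [d [D [E hP]]]] := main_up_premise up hx.
  (* A bound occurrence is already consumed by its ⅋ link. *)
  have : TensN a h c B C = ParP h b d D E.
    apply: (@premise_link_inj _ _ _ _ (neg h C) (neg h D) w hT hP) => //.
      by rewrite !inE eqxx orbT.
    by rewrite mem_head.
  by [].
- by rewrite vars_trename -sz -idx; apply: perm_map.
- apply: (@has_arity_tbind _ (fun i => arg_arity A (index i xs))).
    by move=> i _ /=.
  apply: ars => o; rewrite (perm_mem pG) => /mapP[[a B] hB ->] /=.
  have : (a, B) \in zip xs (args A) by [].
  move=> /(nthP (0, Atom))[i]; rewrite size_zip sz minnn => hi.
  rewrite nth_zip // => -[<- <-]; rewrite /arg_arity index_uniq ?sz //.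
- move=> v u hev.
  have {}hev : evals (fun a => v (index a xs)) s u.
    by move/evals_trename: hev.
  have [e [he ev ey]] := exs _ _ hev.
  have [e' he' eq'] := ext e he.
  exists e' => //; rewrite (main_up_experiment he' up).
  have inM o : o \in pos y Atom :: negs xs (args A) -> e' o.1 = e o.1.
    by move=> ho; apply: eq'; apply: net_conclusion_name ho.
  have -> : e' y = u by rewrite (inM (pos y Atom)) ?mem_head.
  rewrite -sz -idx -map_comp; congr foldr; apply/eq_in_map => a ha /=.
  have haG : a \in unzip1 G0 by rewrite (perm_mem pG1).
  rewrite -(ev _ haG); case/mapP: haG => o ho ->; apply: inM.
  by rewrite inE -(perm_mem pG) ho orbT.
Qed.

(** Only the root has abstractions: the direct subproof nets have atomic conclusions, so the
    relation between variables never grows and the comparison follows the common term. *)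
Lemma represents_eq_normal N N' x x' n s :
  {in vars s, forall i, i < n} ->
  represents N x n s -> represents N' x' n s -> eq_normal N N' [::] x x'.
Proof.
move=> sn [xs [y [z [up sz hI hs nT]]]] [xs' [y' [z' [up' sz' hI' hs' nT']]]].
pose r := zip xs xs' ++ [::].
suff spine t : {in vars t, forall i, i < n} -> forall z z',
    neutral N z (trename (nth 0 xs) t) -> neutral N' z' (trename (nth 0 xs') t) ->
    exists us us' h h', [/\ main_down N z us h, main_down N' z' us' h',
      size us = size us', (h, h') \in r
      & forall u u', (u, u') \in zip us us' -> eq_normal N N' r u u'].
  have [us [us' [h [h' [d d' su hh hu]]]]] := spine _ sn _ _ hs hs'.
  apply: (@eq_normal_intro _ _ _ _ _ xs xs' us us' h h') => //.
  - by exists y, z.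
  - by exists y', z'.
  - by rewrite sz.
elim: t => [i|t IHt q IHq] hn z0 z1; rewrite /trename /=.
  have hi : i < n by apply: hn; rewrite mem_head.
  move=> /neutral_varI-> /neutral_varI->.
  exists [::], [::], (nth 0 xs i), (nth 0 xs' i); split=> //.
  - by apply: down_nil => a c A B; apply: nT; rewrite mem_nth ?sz.
  - by apply: down_nil => a c A B; apply: nT'; rewrite mem_nth ?sz'.
  - rewrite /r cats0 -nth_zip ?sz ?sz' //.
    by apply: mem_nth; rewrite size_zip sz sz' minnn.
move=> /neutral_appI[a [c [A [B [b [hT ha hb hc]]]]]].
move=> /neutral_appI[a' [c' [A' [B' [b' [hT' ha' hb' hc']]]]]].
have [|us [us' [h [h' [d d' su hh hu]]]]] := IHt _ _ _ hc hc'.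
  by move=> i hi; apply: hn; rewrite /= mem_cat hi.
have [|ks [ks' [k [k' [d1 d1' su1 hh1 hu1]]]]] := IHq _ _ _ hb hb'.
  by move=> i hi; apply: hn; rewrite /= mem_cat hi orbT.
exists (a :: us), (a' :: us'), h, h'; split=> //.
- exact: down_cons hT d.
- exact: down_cons hT' d'.
- by rewrite /= su.
- move=> u u'; rewrite /= inE => /orP[/eqP[-> ->]|]; last exact: hu.
  apply: (@eq_normal_intro _ _ r _ _ [::] [::] ks ks' k k') => //.
  + by exists a, b; split=> //; apply: up_nil.
  + by exists a', b'; split=> //; apply: up_nil.
Qed.

(** * Separation of linear terms *)

(** A point of 0 satisfies [x = f1], [f2 = g1], [g2 = y], and a point of 1 satisfies [x = g1],
    [g2 = f1], [f2 = y]. Three distinct labels along such a chain reveal the order of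
    composition. *)
Definition bool_point (x f1 f2 g1 g2 y : nat) : nat :=
  pair x (pair (pair f1 f2) (pair (pair g1 g2) y)).

(* A point of both 0 and 1, given to everything that gets erased; [own_point b]
   is a point of b only. *)
Definition common_point : nat := bool_point 0 0 0 0 0 0.

Definition own_point (b : bool) : nat :=
  if b then bool_point 0 1 2 0 1 2 else bool_point 0 0 1 1 2 2.

Definition const_point (k w : nat) : nat := iter k (pair common_point) w.

Lemma const_pointD i j w : const_point (i + j) w = const_point i (const_point j w).
Proof. exact: iterD. Qed.

Fixpoint head (s : term) : nat := match s with Var i => i | App s _ => head s end.

Lemma head_vars s : head s \in vars s.
Proof. by elim: s => [i|s IH t _] /=; rewrite ?mem_head // mem_cat IH. Qed.

Lemma has_arity_head ar s m : has_arity ar s m -> m <= ar (head s).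
Proof. by elim: s m => [i|s IH t _] m /=; [move=> ->|case=> /IH h _; apply: ltnW]. Qed.

Lemma evals_common ar v s m :
  has_arity ar s m -> {in vars s, forall i, v i = const_point (ar i) common_point} ->
  evals v s (const_point m common_point).
Proof.
elim: s m => [i|s IHs t IHt] m /=.
  by move=> <- h; rewrite h ?mem_head.
case=> hs ht h; exists common_point.
  by apply: (IHt 0 ht) => i hi; apply: h; rewrite mem_cat hi orbT.
by apply: (IHs _ hs) => i hi; apply: h; rewrite mem_cat hi.
Qed.

(** With all arguments at the common point, only the head matters. It has received [ar (head s) - m]
    arguments, and linearity keeps the head itself out of them. *)
Lemma evals_head ar v s m w :
  has_arity ar s m -> uniq (vars s) ->
  v (head s) = const_point (ar (head s) - m) w ->
  {in vars s, forall i, i != head s -> v i = const_point (ar i) common_point} ->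
  evals v s w.
Proof.
elim: s m w => [i|s IHs t _] m w /=.
  by move=> <- _; rewrite subnn.
case=> hs ht; rewrite cat_uniq => /and3P[us /hasPn dis ut] hv hc.
have le := has_arity_head hs.
exists common_point.
  apply: (evals_common (m := 0) ht) => i hi; apply: hc; first by rewrite mem_cat hi orbT.
  by apply: contraNneq (dis _ hi) => ->; exact: head_vars.
apply: (IHs _ _ hs us); last by move=> i hi; apply: hc; rewrite mem_cat hi.
rewrite hv; have -> : ar (head s) - m = ar (head s) - m.+1 + 1 by move: le; clear; lia.
by rewrite const_pointD.
Qed.

(** Constants and projections. For a constant, [b] is chosen before [q], since one net serves both
    experiments; for the projection on argument [i], [b] may vary with [q], since the returned
    boolean comes from outside. Either may deliver the common point instead. *)
Definition realizable (k : nat) (v : bool -> nat) : Prop :=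
  (exists b, forall q, v q = const_point k common_point \/ v q = const_point k (own_point b))
  \/ exists i j, k = i + j.+1 /\ forall q, v q = const_point k common_point \/
       exists b, v q = const_point i (pair (own_point b) (const_point j (own_point b))).

Lemma term_eq_dec (s t : term) : {s = t} + {s <> t}.
Proof. by decide equality; exact: PeanoNat.Nat.eq_dec. Qed.

(* Follow a path to the first position where the terms have different heads:
   the variables on the path become projections along it, and the two heads
   become distinct constants. By linearity neither head lies on the path. *)
Lemma linear_terms_separable ar s1 s2 m :
  has_arity ar s1 m -> has_arity ar s2 m -> uniq (vars s1) -> uniq (vars s2) ->
  s1 <> s2 ->
  exists v : bool -> nat -> nat,
    [/\ forall i, realizable (ar i) (v^~ i),
        evals (v false) s1 (const_point m (own_point false)),
        evals (v true) s2 (const_point m (own_point true)),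
        forall i, i \notin vars s1 -> v false i = const_point (ar i) common_point
      & forall i, i \notin vars s2 -> v true i = const_point (ar i) common_point].
Proof.
elim: s1 s2 m => [i1|s1 IHs t1 IHt] s2 m a1 a2 u1 u2 ne.
all: match goal with |- context [vars ?S] => set s := S in a1 u1 ne * end.
all: have [eh|nh] := eqVneq (head s) (head s2); last first.
(* Different heads: the first becomes the constant 0 and the second the constant 1, each at its own
   point only in the experiment of its own term. *)
1,3: exists (fun q i => if q then
        (if i == head s2 then const_point (ar i) (own_point true) else const_point (ar i) common_point)
      else (if i == head s then const_point (ar i) (own_point false) else const_point (ar i) common_point));
  split;
  [ move=> i; left;
    have [->|n1] := eqVneq i (head s);
    [ exists false; case; rewrite ?(negbTE nh) ?eqxx; [by left|by right]
    | exists true; case; [by case: ifP; [right|left]|by left] ]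
  | apply: (evals_head a1 u1); [by rewrite eqxx -const_pointD subnK // has_arity_head
                               |by move=> i _ /negbTE->]
  | apply: (evals_head a2 u2); [by rewrite eqxx -const_pointD subnK // has_arity_head
                               |by move=> i _ /negbTE->]
  | by move=> i; case: eqP => // -> ; rewrite head_vars
  | by move=> i; case: eqP => // -> ; rewrite head_vars ].
- case: s2 a2 u2 ne eh => [i2|s2 t2] a2 u2 ne /= eh.
    by case: ne; rewrite /s eh.
  (* An application with this head would need an arity above [m]. *)
  have := has_arity_head (proj1 a2).
  by move: a1; rewrite /s /= => <-; rewrite eh ltnn.
- case: s2 a2 u2 ne eh => [i2|s2 t2] a2 u2 ne /= eh.
    have := has_arity_head (proj1 a1); move: a2 => /= <-.
    by rewrite -eh ltnn.
  case: a1 a2 => [a1 b1] [a2 b2].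
  move: u1 u2; rewrite /= !cat_uniq => /and3P[u1 /hasPn d1 w1] /and3P[u2 /hasPn d2 w2].
  (* If the function parts differ, the last two clauses of the induction hypothesis put the
     arguments at the common point. Otherwise the difference lies in the arguments and the shared
     head has to project on them. *)
  have [e|n] := term_eq_dec s1 s2; last first.
    have [v [h1 h2 h3 h4 h5]] := IHs _ _ a1 a2 u1 u2 n.
    exists v; split=> //.
    + exists common_point; last exact: h2.
      by apply: (evals_common (m := 0) b1) => i hi; apply: h4; apply: d1.
    + exists common_point; last exact: h3.
      by apply: (evals_common (m := 0) b2) => i hi; apply: h5; apply: d2.
    + by move=> i; rewrite mem_cat negb_or => /andP[/h4].
    + by move=> i; rewrite mem_cat negb_or => /andP[/h5].
  subst s2; have n : t1 <> t2 by move=> e; apply: ne; rewrite /s e.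
  have [v [h1 h2 h3 h4 h5]] := IHt _ _ b1 b2 w1 w2 n.
  pose z := head s1; have le := has_arity_head a1.
  have hz1 : z \notin vars t1 by apply/negP => /d1/negP; apply; exact: head_vars.
  have hz2 : z \notin vars t2 by apply/negP => /d2/negP; apply; exact: head_vars.
  (* The selected argument is preceded by [ar z - m.+1] others and followed by the [m] missing
     ones. *)
  pose v' q i := if i == z then const_point (ar z - m.+1)
      (pair (own_point q) (const_point m (own_point q))) else v q i.
  have same q t : z \notin vars t -> {in vars t, v q =1 v' q}.
    by move=> hz i hi; rewrite /v'; case: eqP => // e; case/negP: hz; rewrite -e.
  exists v'; split.
  + move=> i; rewrite /realizable /v'; case: eqP => [->|_]; last exact: h1.
    right; exists (ar z - m.+1), m; split; first by move: le; rewrite -/z; clear; lia.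
    by move=> q; right; exists q.
  + exists (own_point false).
      by apply: eq_in_evals h2; apply: same.
    apply: (evals_head a1 u1); first by rewrite /v' eqxx.
    move=> i hi hn; rewrite /v' (negbTE hn); apply: h4.
    by apply/negP => /d1/negP.
  + exists (own_point true).
      by apply: eq_in_evals h3; apply: same.
    apply: (evals_head a1 u1); first by rewrite /v' eqxx.
    move=> i hi hn; rewrite /v' (negbTE hn); apply: h5.
    by apply/negP => /d2/negP.
  + move=> i; rewrite mem_cat negb_or => /andP[ns nt]; rewrite /v'.
    by case: eqP => [e|_]; [case/negP: ns; rewrite e head_vars|exact: h4].
  + move=> i; rewrite mem_cat negb_or => /andP[ns nt]; rewrite /v'.
    by case: eqP => [e|_]; [case/negP: ns; rewrite e head_vars|exact: h5].
Qed.

(** * Nets with prescribed experiments *)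

(** One net with two experiments; [E] gives the formulas and labels of its free variables. The lower
    bound [n] on names allows nets to be made disjoint before they are joined. *)
Definition realized (E : seq (formula * (bool -> nat))) (A : formula) (v : bool -> nat) : Prop :=
  forall n, exists L x g (e : bool -> nat -> nat),
    [/\ extended_net L (pos x A :: negs g (unzip1 E)), size g = size E,
        ~~ has is_hole L, {in names L, forall y, n <= y}
      & forall q, [/\ experiment (e q) L, e q x = v q & map (e q) g = [seq p.2 q | p <- E]]].

Lemma map_occ_negs f g xs As :
  map (occ_map f g) (negs xs As) = negs (map f xs) (map g As).
Proof. by elim: xs As => [|x xs IH] [|A As] //; rewrite /negs /=; congr (_ :: _); exact: IH. Qed.

Lemma realized_intro L x g e E A v :
  extended_net L (pos x A :: negs g (unzip1 E)) -> size g = size E -> ~~ has is_hole L ->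
  (forall q : bool, [/\ experiment (e q) L, e q x = v q & map (e q) g = [seq p.2 q | p <- E]]) ->
  realized E A v.
Proof.
move=> net sz nh he n; pose f x := x + n.
have finj : injective f by move=> a b; rewrite /f => /addIn.
exists (map (link_map f id) L), (f x), (map f g), (fun q y => e q (y - n)); split.
- have := net_map (g := id) (fun _ _ => erefl) net (in2W finj).
  by rewrite /= map_occ_negs map_id.
- by rewrite size_map.
- by rewrite has_hole_map.
- by move=> y; rewrite names_link_map => /mapP[z _ ->]; apply: leq_addl.
- move=> q; have [h1 h2 h3] := he q; split.
  + apply/experiment_map; apply: eq_in_experiment h1 => y _ /=; by rewrite /f addnK.
  + by rewrite /f addnK.
  + by rewrite -h3 -map_comp; apply: eq_map => y /=; rewrite /f addnK.
Qed.

Lemma eq_realized E A v v' : v =1 v' -> realized E A v -> realized E A v'.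
Proof.
move=> ev h n; have [L [x [g [e [h1 h2 h3 h4 h5]]]]] := h n.
by exists L, x, g, e; split=> // q; have [? ? ?] := h5 q; rewrite -ev.
Qed.

Lemma realized_id A v : realized [:: (A, v)] A v.
Proof.
apply: (@realized_intro [:: Id 0 1 A] 0 [:: 1] (fun q _ => v q)) => //; first exact: net_id.
by move=> q; split=> // l; rewrite inE => /eqP->.
Qed.

Lemma merge_experiments L1 L2 e1 e2 :
  disjoint_names L1 L2 -> experiment e1 L1 -> experiment e2 L2 ->
  let e x := if x \in names L1 then e1 x else e2 x in
  [/\ experiment e L1, experiment e L2, {in names L1, e =1 e1} & {in names L2, e =1 e2}].
Proof.
move=> /disjoint_namesP dis h1 h2 e.
have H1 : {in names L1, e =1 e1} by move=> x hx; rewrite /e hx.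
have H2 : {in names L2, e =1 e2}.
  by move=> x hx; rewrite /e; case: ifP => // h; case: (dis x).
split=> //; [apply: eq_in_experiment h1|apply: eq_in_experiment h2] => x hx.
  by rewrite H1.
by rewrite H2.
Qed.

Lemma net_negs_names L o xs As :
  extended_net L (o :: negs xs As) -> size xs = size As -> {subset xs <= names L}.
Proof.
move=> n sz x; rewrite -{1}(unzip1_negs sz) => /mapP[o' ho ->].
by apply: (net_conclusion_name n); rewrite inE ho orbT.
Qed.

Lemma realized_lam E A B u v :
  realized ((A, u) :: E) B v -> realized E (A ⊸ B) (fun q => pair (u q) (v q)).
Proof.
move=> h n; have [L [x [[|a g] [e [h1 //= [h2] h3 h4 h5]]]]] := h n.
have [m hm] := fresh_bound (n :: names L).
have mL : m \notin names L by apply/negP => hx; have := hm m; rewrite inE hx orbT ltnn => /(_ isT).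
have nm : n <= m by apply: ltnW; apply: hm; rewrite mem_head.
have aL : a \in names L by apply: (net_conclusion_name (o := neg a A) h1); rewrite !inE eqxx orbT.
have xL : x \in names L by apply: (net_conclusion_name (o := pos x B) h1); rewrite mem_head.
exists (ParP a x m A B :: L), m, g, (fun q y => if y == m then pair (u q) (v q) else e q y).
have eE q y : y \in names L -> (if y == m then pair (u q) (v q) else e q y) = e q y.
  by move=> hy; case: eqP => // ym; case/negP: mL; rewrite -ym.
split=> //.
- apply: net_par mL; apply: net_perm h1 => //.
  by rewrite /negs /=; perm_by_count.
- move=> y; rewrite mem_names_cons /= !inE -!orbA => /or4P[/eqP->|/eqP->|/eqP->//|]; exact: h4.
- move=> q; have [k1 k2 k3] := h5 q; split.
  + apply/experiment_cons; split.
      by rewrite /= (eE q a) // (eE q x) // eqxx k2; case: k3 => ->.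
    by apply: eq_in_experiment k1 => y hy; rewrite eE.
  + by rewrite eqxx.
  + case: k3 => _ <-; apply/eq_in_map => y hy; apply: eE.
    apply: (net_negs_names (xs := a :: g) h1); first by rewrite /= h2 size_map.
    by rewrite inE hy orbT.
Qed.

(** Both orders are provided because [E] is ordered: an erased variable can then be added on either
    side. *)
Lemma realized_cut E F A B u v :
  realized E A u -> realized ((A, u) :: F) B v ->
  realized (E ++ F) B v /\ realized (F ++ E) B v.
Proof.
move=> h1 h2.
suff H n : exists L x g1 g2 (e : bool -> nat -> nat),
  [/\ [/\ extended_net L (pos x B :: negs g1 (unzip1 E) ++ negs g2 (unzip1 F)),
      size g1 = size E & size g2 = size F],
      ~~ has is_hole L, {in names L, forall y, n <= y}
    & forall q, [/\ experiment (e q) L, e q x = v q,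
        map (e q) g1 = [seq p.2 q | p <- E] & map (e q) g2 = [seq p.2 q | p <- F]]].
  have catE g1 g2 (E1 E2 : seq (formula * (bool -> nat))) : size g1 = size E1 ->
      negs (g1 ++ g2) (unzip1 (E1 ++ E2)) = negs g1 (unzip1 E1) ++ negs g2 (unzip1 E2).
    by move=> s1; rewrite /negs /unzip1 map_cat zip_cat ?map_cat // size_map.
  split=> n; have [L [x [g1 [g2 [e [[k1 s1 s2] k2 k3 k4]]]]]] := H n.
    exists L, x, (g1 ++ g2), e; split=> //; first by rewrite catE.
      by rewrite !size_cat s1 s2.
    by move=> q; have [? ? a b] := k4 q; split=> //; rewrite !map_cat a b.
  exists L, x, (g2 ++ g1), e; split=> //.
  - by rewrite catE //; apply: net_perm k1 => //; perm_by_count.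
  - by rewrite !size_cat s1 s2.
  - by move=> q; have [? ? a b] := k4 q; split=> //; rewrite !map_cat a b.
have [L1 [x1 [g1 [e1 [n1 s1 nh1 b1 p1]]]]] := h1 n.
have [m hm] := fresh_bound (n :: names L1).
have nm : n <= m by apply: ltnW; apply: hm; rewrite mem_head.
have [L2 [x [[|a g2] [e2 [n2 //= [s2] nh2 b2 p2]]]]] := h2 m.
have dis : disjoint_names L1 L2.
  apply/disjoint_namesP => y y1 /b2; rewrite leqNgt => /negP; apply; apply: hm.
  by rewrite inE y1 orbT.
have x1L : x1 \in names L1 by apply: (net_conclusion_name (o := pos x1 A) n1); rewrite mem_head.
have xL : x \in names L2 by apply: (net_conclusion_name (o := pos x B) n2); rewrite mem_head.
have gL1 : {subset g1 <= names L1} by apply: (net_negs_names n1); rewrite size_map.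
have gL2 : {subset a :: g2 <= names L2}.
  by apply: (net_negs_names (xs := a :: g2) n2); rewrite /= s2 size_map.
have aL : a \in names L2 by apply: gL2; rewrite mem_head.
exists (Cut x1 a A :: L1 ++ L2), x, g1, g2,
  (fun q y => if y \in names L1 then e1 q y else e2 q y); split.
- split=> //.
  have n2' : extended_net L2 (neg a A :: pos x B :: negs g2 (unzip1 F)).
    by apply: net_perm n2 => //; rewrite /negs /=; perm_by_count.
  by apply: net_perm (net_cut n1 n2' dis) => //; perm_by_count.
- by rewrite /= has_cat negb_or nh1.
- move=> y; rewrite mem_names_cons names_cat mem_cat /= !inE -!orbA.
  case/or4P=> [/eqP->|/eqP->|hy|hy]; try exact: b1; exact: leq_trans nm (b2 _ _).
- move=> q; have [k1 k2 k3] := p1 q; have [l1 l2 [l3 l4]] := p2 q.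
  have [m1 m2 E1 E2] := merge_experiments dis k1 l1; split.
  + apply/experiment_cons; split; first by rewrite /= E1 // E2 // k2 l3.
    by apply/experiment_cat.
  + by rewrite E2.
  + by rewrite -k3; apply/eq_in_map => y /gL1; apply: E1.
  + by rewrite -l4; apply/eq_in_map => y hy; apply: E2; apply: gL2; rewrite inE hy orbT.
Qed.

Lemma realized_app A B C u w v p :
  (forall q, p q = pair (u q) (w q)) ->
  realized [::] A u -> realized [:: (B, w)] C v -> realized [:: (A ⊸ B, p)] C v.
Proof.
move=> hp h1 h2 n.
have [L1 [x1 [[|? ?] [e1 [n1 // s1 nh1 b1 p1]]]]] := h1 n.
have [m hm] := fresh_bound (n :: names L1).
have nm : n <= m by apply: ltnW; apply: hm; rewrite mem_head.
have [L2 [x [[|a [|? ?]] [e2 [n2 // s2 nh2 b2 p2]]]]] := h2 m.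
have dis : disjoint_names L1 L2.
  apply/disjoint_namesP => y y1 /b2; rewrite leqNgt => /negP; apply; apply: hm.
  by rewrite inE y1 orbT.
have x1L : x1 \in names L1 by apply: (net_conclusion_name (o := pos x1 A) n1); rewrite mem_head.
have xL : x \in names L2 by apply: (net_conclusion_name (o := pos x C) n2); rewrite mem_head.
have aL : a \in names L2.
  by apply: (net_conclusion_name (o := neg a B) n2); rewrite !inE eqxx orbT.
have [c hc] := fresh_bound (n :: names (L1 ++ L2)).
have cL : c \notin names (L1 ++ L2).
  by apply/negP => hx; have := hc c; rewrite inE hx orbT ltnn => /(_ isT).
have nc : n <= c by apply: ltnW; apply: hc; rewrite mem_head.
pose e q y := if y == c then pair (u q) (w q) else if y \in names L1 then e1 q y else e2 q y.
exists (TensN x1 a c A B :: L1 ++ L2), x, [:: c], e; split=> //.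
- have n2' : extended_net L2 (neg a B :: [:: pos x C]).
    by apply: net_perm n2 => //; rewrite /negs /=; perm_by_count.
  by apply: net_perm (net_tens n1 n2' dis cL) => //; rewrite /negs /=; perm_by_count.
- by rewrite /= has_cat negb_or nh1.
- move=> y; rewrite mem_names_cons names_cat mem_cat /= !inE -!orbA.
  move=> hy; do !(case/orP: hy => hy); try (move/eqP: hy => ->) => //;
    try exact: b1; exact: leq_trans nm (b2 _ _).
- move=> q; have [k1 k2 _] := p1 q; have [l1 l2 [l3]] := p2 q.
  have [m1 m2 E1 E2] := merge_experiments dis k1 l1.
  have eE y : y \in names (L1 ++ L2) -> e q y = if y \in names L1 then e1 q y else e2 q y.
    by move=> hy; rewrite /e; case: eqP => // yc; case/negP: cL; rewrite -yc.
  have in1 y : y \in names L1 -> y \in names (L1 ++ L2) by rewrite names_cat mem_cat => ->.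
  have in2 y : y \in names L2 -> y \in names (L1 ++ L2) by rewrite names_cat mem_cat orbC => ->.
  split.
  + apply/experiment_cons; split.
      rewrite /= (eE x1) ?in1 // (eE a) ?in2 //.
      have -> : e q c = pair (u q) (w q) by rewrite /e eqxx.
      by rewrite E1 // E2 // k2 l3.
    have : experiment (fun y => if y \in names L1 then e1 q y else e2 q y) (L1 ++ L2).
      by apply/experiment_cat.
    by apply: eq_in_experiment => y hy; rewrite eE.
  + by rewrite eE ?in2 // E2.
  + by rewrite /= /e eqxx hp.
Qed.

Lemma net_reorder L G G' : extended_net L G -> perm_eq G G' -> extended_net L G'.
Proof. by move=> n p; apply: net_perm n. Qed.

(* λx.λf.λg. m (b x I I) f g, with b = 0, m = 1 and conclusion 2: the identities
   make b erase itself. *)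
Definition erase_links : seq link :=
  let p := Atom in let f := p ⊸ p in
  [:: ParP 3 24 2 p (f ⊸ f ⊸ p), ParP 4 23 24 f (f ⊸ p), ParP 5 6 23 f p,
      TensN 17 18 1 p (f ⊸ f ⊸ p)
    & ([:: TensN 7 14 0 p (f ⊸ f ⊸ p), Id 7 3 p, TensN 10 15 14 f (f ⊸ p)
         & [:: ParP 9 8 10 p p; Id 8 9 p] ++ [:: TensN 13 16 15 f p
         & [:: ParP 12 11 13 p p; Id 11 12 p] ++ [:: Id 17 16 p]]])
      ++ [:: TensN 19 20 18 f (f ⊸ p), Id 19 4 f, TensN 21 22 20 f p, Id 21 5 f
         & [:: Id 6 22 p]]].

Lemma erase_net : extended_net erase_links [:: pos 2 boolF; neg 1 boolF; neg 0 boolF].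
Proof.
rewrite /erase_links; set p := Atom; set f := p ⊸ p.
have id1 : extended_net [:: ParP 9 8 10 p p; Id 8 9 p] [:: pos 10 f].
  by apply: net_par; [apply: net_perm (net_id _ _) => //; perm_by_count|].
have id2 : extended_net [:: ParP 12 11 13 p p; Id 11 12 p] [:: pos 13 f].
  by apply: net_par; [apply: net_perm (net_id _ _) => //; perm_by_count|].
have ax a b A : a != b -> extended_net [:: Id a b A] [:: neg b A; pos a A].
  by move=> ab; apply: net_perm (net_id A ab) => //; perm_by_count.
have b1 := @net_tens _ _ _ _ 13 16 15 f p id2 (ax 17 16 p isT) isT isT.
have b2 := @net_tens _ _ _ _ 10 15 14 f (f ⊸ p) id1 b1 isT isT.
have b3 := @net_tens _ _ _ _ 7 14 0 p (f ⊸ f ⊸ p) (@net_id 7 3 p isT) b2 isT isT.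
have m1 := @net_tens _ _ _ _ 21 22 20 f p (@net_id 21 5 f isT) (ax 6 22 p isT) isT isT.
have m2 := @net_tens _ _ _ _ 19 20 18 f (f ⊸ p) (@net_id 19 4 f isT) m1 isT isT.
have b3' := net_reorder (G' := [:: pos 17 p; neg 0 boolF; neg 3 p]) b3 isT.
have m3 := @net_tens _ _ _ _ 17 18 1 p (f ⊸ f ⊸ p) b3' m2 isT isT.
have m3' := net_reorder (G' := [:: neg 5 f, pos 6 p, neg 4 f, neg 3 p
   & [:: neg 1 boolF; neg 0 boolF]]) m3 isT.
have l1 := @net_par _ _ 5 6 23 f p m3' isT.
have l1' := net_reorder (G' := [:: neg 4 f, pos 23 (f ⊸ p), neg 3 p
   & [:: neg 1 boolF; neg 0 boolF]]) l1 isT.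
have l2 := @net_par _ _ 4 23 24 f (f ⊸ p) l1' isT.
have l2' := net_reorder (G' := [:: neg 3 p, pos 24 (f ⊸ f ⊸ p)
   & [:: neg 1 boolF; neg 0 boolF]]) l2 isT.
exact: (@net_par _ _ 3 24 2 p (f ⊸ f ⊸ p) l2' isT).
Qed.

(** The erased boolean is at the common point, whose input and output are both 0. Its output feeds
    the returned boolean, whose point must therefore begin with 0. *)
Lemma realized_erase v :
  (forall q, exists r, v q = pair 0 r) ->
  realized [:: (boolF, v); (boolF, fun => common_point)] boolF v.
Proof.
move=> hv.
(* The entry at position k is the label of the occurrence named k. *)
pose e q := nth 0 (let r := pair_snd (v q) in let F := pair_fst r in let r' := pair_snd r in
  let D := pair 0 0 in
  [:: common_point; v q; v q; 0; F; pair_fst r'; pair_snd r'; 0; 0; 0; D; 0; 0; D;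
      pair D (pair D 0); pair D 0; 0; 0; r; F; r'; pair_fst r'; pair_snd r'; r'; r]).
apply: (@realized_intro erase_links 2 [:: 1; 0] e) => //; first exact: erase_net.
move=> q; split=> //.
have v0 : v q = pair 0 (pair_snd (v q)).
  have [r hr] := hv q; rewrite -{1}(pair_eta (v q)); congr pair.
  by move: (pair_eta (v q)); rewrite [RHS]hr => /pair_inj[].
by do !(apply/experiment_cons; split; first by rewrite /e /= ?pair_eta).
Qed.

(** * Projections, constants and booleans *)

Definition dummy : formula * (bool -> nat) := (boolF, fun => common_point).

Lemma realized_weaken i j E v :
  (forall q, exists r, v q = pair 0 r) -> realized E boolF v ->
  realized (nseq i dummy ++ E ++ nseq j dummy) boolF v.
Proof.
move=> hv h; have er := realized_erase hv.
elim: i => [|i IH].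
  elim: j => [|j IH]; first by rewrite cats0.
  by rewrite -addn1 nseqD !catA; have [] := realized_cut IH er.
by have [_] := realized_cut IH er.
Qed.

(** The fold abstracts the first variable first, hence innermost: arguments come in the reverse
    order of [E]. *)
Lemma realized_lams E B v :
  realized E B v ->
  realized [::] (foldl (fun C p => p.1 ⊸ C) B E)
                (foldl (fun w p q => pair (p.2 q) (w q)) v E).
Proof. by elim: E B v => [|[A u] E IH] B v //= /realized_lam /IH. Qed.

(** * The boolean nets and their points *)

Lemma zero_net_correct : closed_net zero_net boolF.
Proof.
split=> //; rewrite /closed_extended_net /=; set p := Atom; set f := p ⊸ p.
have ax a b A : a != b -> extended_net [:: Id a b A] [:: neg b A; pos a A].
  by move=> ab; apply: net_reorder (net_id A ab) _; perm_by_count.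
have t1 := @net_tens _ _ _ _ 7 8 1 p p (@net_id 7 0 p isT) (ax 9 8 p isT) isT isT.
have t1' := net_reorder (G' := [:: pos 9 p; neg 1 f; neg 0 p]) t1 isT.
have t2 := @net_tens _ _ _ _ 9 10 2 p p t1' (ax 3 10 p isT) isT isT.
have t2' := net_reorder (G' := [:: neg 2 f; pos 3 p; neg 1 f; neg 0 p]) t2 isT.
have l1 := @net_par _ _ 2 3 4 f p t2' isT.
have l1' := net_reorder (G' := [:: neg 1 f; pos 4 (f ⊸ p); neg 0 p]) l1 isT.
have l2 := @net_par _ _ 1 4 5 f (f ⊸ p) l1' isT.
have l2' := net_reorder (G' := [:: neg 0 p; pos 5 (f ⊸ f ⊸ p)]) l2 isT.
by apply: net_perm (@net_par _ _ 0 5 6 p (f ⊸ f ⊸ p) l2' isT).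
Qed.

Lemma one_net_correct : closed_net one_net boolF.
Proof.
split=> //; rewrite /closed_extended_net /=; set p := Atom; set f := p ⊸ p.
have ax a b A : a != b -> extended_net [:: Id a b A] [:: neg b A; pos a A].
  by move=> ab; apply: net_reorder (net_id A ab) _; perm_by_count.
have t1 := @net_tens _ _ _ _ 7 8 2 p p (@net_id 7 0 p isT) (ax 9 8 p isT) isT isT.
have t1' := net_reorder (G' := [:: pos 9 p; neg 2 f; neg 0 p]) t1 isT.
have t2 := @net_tens _ _ _ _ 9 10 1 p p t1' (ax 3 10 p isT) isT isT.
have t2' := net_reorder (G' := [:: neg 2 f; pos 3 p; neg 1 f; neg 0 p]) t2 isT.
have l1 := @net_par _ _ 2 3 4 f p t2' isT.
have l1' := net_reorder (G' := [:: neg 1 f; pos 4 (f ⊸ p); neg 0 p]) l1 isT.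
have l2 := @net_par _ _ 1 4 5 f (f ⊸ p) l1' isT.
have l2' := net_reorder (G' := [:: neg 0 p; pos 5 (f ⊸ f ⊸ p)]) l2 isT.
by apply: net_perm (@net_par _ _ 0 5 6 p (f ⊸ f ⊸ p) l2' isT).
Qed.

Definition bool_net (b : bool) : rooted := if b then one_net else zero_net.

(** [s], [t], [u] label the chain from the input through the two functions to the output. *)
Lemma bool_net_experiment b (s t u : nat) :
  exists2 e, experiment e (links (bool_net b))
           & e 6 = if b then bool_point s t u s t u else bool_point s s t t u u.
Proof.
pose g := if b then pair s t else pair t u; pose f := if b then pair t u else pair s t.
exists (nth 0 [:: s; f; g; u; pair g u; pair f (pair g u);
                  pair s (pair f (pair g u)); s; t; t; u]); last by rewrite /f /g; case: (b).
by rewrite /f /g {f g}; case: b; do !(apply/experiment_cons; split=> //).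
Qed.

Lemma realized_bool_net b v :
  (forall q, v q = common_point \/ v q = own_point b) -> realized [::] boolF v.
Proof.
move=> hv.
have [e1 h1 k1] := bool_net_experiment b 0 0 0.
have [e2 h2 k2] := bool_net_experiment b 0 1 2.
have [n nh] : closed_net (bool_net b) boolF.
  by case: b {hv h1 k1 h2 k2}; [exact: one_net_correct|exact: zero_net_correct].
have c6 : ccl (bool_net b) = 6 by case: (b).
rewrite /closed_extended_net c6 in n.
apply: (@realized_intro _ 6 [::] (fun q => if v q == common_point then e1 else e2) [::] _ _ n) => // q.
case: eqP => [->|ne]; split=> //.
  by rewrite k1 /common_point; case: (b).
by case: (hv q) => // ->; rewrite k2 /own_point; case: (b).
Qed.

Lemma foldl_dummy_point k v q :
  foldl (fun w (p : formula * (bool -> nat)) q => pair (p.2 q) (w q)) v (nseq k dummy) q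
  = const_point k (v q).
Proof.
elim: k v => [|k IH] v //=; rewrite IH /= /const_point.
by rewrite -iterS iterSr.
Qed.

Lemma foldl_dummy_formula k B :
  foldl (fun C (p : formula * (bool -> nat)) => p.1 ⊸ C) B (nseq k dummy)
  = iter k (Limp boolF) B.
Proof. by elim: k B => [|k IH] B //=; rewrite IH /= -iterS iterSr. Qed.

Lemma common_or_own_fst b w :
  w = common_point \/ w = own_point b -> exists r, w = pair 0 r.
Proof.
rewrite /common_point /own_point /bool_point; case=> ->; first by eexists.
by case: b; eexists.
Qed.

Lemma realizable_realized k v :
  realizable k v -> realized [::] (iter k (Limp boolF) boolF) v.
Proof.
case=> [[b hv]|[i [j [-> hv]]]].
  pose w q := if v q == const_point k common_point then common_point else own_point b.
  have hw q : w q = common_point \/ w q = own_point b.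
    by rewrite /w; case: ifP; [left|right].
  have := realized_weaken 0 k (fun q => common_or_own_fst (hw q)) (realized_bool_net hw).
  move=> /realized_lams; rewrite /= foldl_dummy_formula; apply: eq_realized => q.
  rewrite foldl_dummy_point /w; case: eqP => [->//|ne].
  by case: (hv q) => // ->.
pose P w := const_point i (pair w (const_point j w)).
(* The boolean projected at [q] is recovered from the label by an equality test. *)
pose w q := if v q == const_point (i + j.+1) common_point then common_point
            else own_point (v q == P (own_point true)).
have hw q : exists r, w q = pair 0 r.
  rewrite /w; case: ifP => _; first by apply: (@common_or_own_fst true); left.
  by apply: common_or_own_fst; right.
(* Abstraction reverses the order, so the [j] later arguments stand in front and the [i] earlier
   ones behind. *)
have := realized_weaken j i hw (realized_id boolF w).
move=> /realized_lams; rewrite !foldl_cat foldl_dummy_formula [X in realized _ X]/=.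
rewrite foldl_dummy_formula.
have -> : iter i (Limp boolF) (boolF ⊸ iter j (Limp boolF) boolF)
          = iter (i + j.+1) (Limp boolF) boolF by rewrite iterD.
apply: eq_realized => q; rewrite foldl_dummy_point /= foldl_dummy_point.
rewrite -/(P (w q)) /w; case: eqP => [->|ne]; first by rewrite const_pointD.
case: (hv q) => // -[[] hb]; first by rewrite hb eqxx.
by case: eqP => [->//|_]; rewrite hb.
Qed.

(** Order at most 2 means atomic arguments, so substitution gives a first-order function type over
    [B]. *)
Lemma fsubst_order2 B A :
  formula_order A <= 2 -> fsubst B A = iter (arity A) (Limp B) B.
Proof. by elim: A => //= A _ C IH /order2_limp[-> /IH ->]. Qed.

(** The separating net before the hole is attached: its one free variable, standing for the plugged
    net, is applied to all the chosen constants and projections. *)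
Lemma realized_applications A (v : nat -> bool -> nat) (w p : bool -> nat) :
  all (fun B => formula_order B <= 2) (args A) ->
  (forall i, i < size (args A) -> realizable (arg_arity A i) (v i)) ->
  (forall q, p q = foldr pair (w q) [seq v i q | i <- iota 0 (size (args A))]) ->
  realized [:: (fsubst boolF A, p)] boolF w.
Proof.
elim: A v p => [|A1 _ A2 IH] v p /=.
  by move=> _ _ hp; apply: eq_realized (realized_id _ _).
case/andP=> o1 o2 hv hp.
have r1 : realized [::] (fsubst boolF A1) (v 0).
  by rewrite fsubst_order2 //; apply: realizable_realized; apply: (hv 0).
have r2 := IH (fun i => v i.+1) _ o2 (fun i hi => hv i.+1 hi) (fun _ => erefl).
apply: realized_app r1 r2 => q; rewrite hp; congr pair.
by rewrite -[1]/(1 + 0) iotaDl -map_comp.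
Qed.

Definition bool_term (b : bool) : term :=
  if b then App (Var 1) (App (Var 2) (Var 0)) else App (Var 2) (App (Var 1) (Var 0)).

Lemma bool_net_represents b : represents (links (bool_net b)) 6 3 (bool_term b).
Proof.
exists [:: 0; 1; 2], 3, 10; split.
- have up : main_up bool_abs 6 [:: 0; 1; 2] 3.
    apply: (@up_cons _ 0 5 6 Atom ((Atom ⊸ Atom) ⊸ (Atom ⊸ Atom) ⊸ Atom)); first by [].
    apply: (@up_cons _ 1 4 5 (Atom ⊸ Atom) ((Atom ⊸ Atom) ⊸ Atom)); first by [].
    by apply: (@up_cons _ 2 3 4 (Atom ⊸ Atom) Atom); [|apply: up_nil].
  by apply: main_up_sub up => l hl; case: b; rewrite mem_cat hl orbT.
- by [].
- by case: b.
- case: b.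
    apply: (@neutral_app _ 9 10 1 Atom Atom 8) => //; last exact: neutral_var.
    by apply: (@neutral_app _ 7 8 2 Atom Atom 0) => //; exact: neutral_var.
  apply: (@neutral_app _ 9 10 2 Atom Atom 8) => //; last exact: neutral_var.
  by apply: (@neutral_app _ 7 8 1 Atom Atom 0) => //; exact: neutral_var.
- have nT : all (fun l => if l is TensN _ h _ _ _ then h \notin [:: 0; 1; 2] else true)
              (links (bool_net b)) by case: b.
  by move=> h a c A B hh; apply/negP => /(allP nT); rewrite hh.
Qed.

Lemma bool_net_normal b : all normal_link (links (bool_net b)).
Proof. by case: b. Qed.

(** The variables have arities 0, 1, 1 and occur once each; only the order of the two functions is
    free. *)
Lemma boolF_term s :
  perm_eq (vars s) (iota 0 3) -> has_arity (arg_arity boolF) s 0 ->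
  exists b, s = bool_term b.
Proof.
have ar2 i : arg_arity boolF i <= 1 by case: i => [|[|[|[|]]]].
case: s => [i|s t] /= pv; first by have := perm_size pv.
case=> hs ht.
case: s hs pv => [i|s1 s2] /=; last first.
  by case=> /has_arity_head h; have := leq_trans h (ar2 _).
case: t ht => [j|t u] /=; first by move=> _ _ /perm_size.
case=> ht hu hi; case: t ht => [j|t1 t2] /=; last first.
  by case=> /has_arity_head h; have := leq_trans h (ar2 _).
case: u hu => [k|u1 u2] /= hk hj pv; last first.
  have := perm_size pv; rewrite /= !size_cat.
  have sz r : 0 < size (vars r) by case: r => //= r r'; rewrite size_cat; have := head_vars r; case: (vars r).
  by have := sz u1; have := sz u2; clear; lia.
have mi : i \in iota 0 3 by rewrite -(perm_mem pv) !inE eqxx.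
have mj : j \in iota 0 3 by rewrite -(perm_mem pv) !inE eqxx orbT.
have mk : k \in iota 0 3 by rewrite -(perm_mem pv) !inE eqxx !orbT.
move: mi mj mk hi hj hk pv; rewrite !inE.
move=> /or3P[] /eqP-> /or3P[] /eqP-> /or3P[] /eqP-> //= _ _ _ // _.
  by exists true.
by exists false.
Qed.

(** The other boolean would identify distinct labels of [own_point b]. *)
Lemma normal_bool_net N x e b :
  extended_net N [:: pos x boolF] -> all normal_link N ->
  experiment e N -> e x = own_point b -> represents N x 3 (bool_term b).
Proof.
move=> n nN he ex.
have [s [rep pv ha _]] := closed_normal_net_term n nN isT.
have [b' eb] := boolF_term pv ha; subst s.
have [//|nb] := eqVneq b' b; first by move=> <-.
case: rep => [xs [y [z [up sz hI hs _]]]].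
move: (neutral_evals he hs) => /evals_trename ev.
move: (main_up_experiment he up); rewrite ex.
case: xs sz ev {up hs} => [|x0 [|x1 [|x2 [|//]]]] //= _.
rewrite /own_point /bool_point.
case: b b' nb {ex pv ha} => [] [] // _ /= [u [u' <- h1] h2] /pair_inj[h0 /pair_inj[k1 /pair_inj[k2 _]]].
  by move: h1; rewrite -k1 -h0 => /pair_inj[].
by move: h1; rewrite -k2 -h0 => /pair_inj[].
Qed.

(** * The separating context *)

Lemma fill_without_hole (F : nat -> seq link) L :
  ~~ has is_hole L ->
  flatten [seq if l is Hole h _ then F h else [:: l] | l <- L] = L.
Proof. by elim: L => //= l L IH /norP[nl /IH ->]; case: l nl. Qed.

(** The hole takes the name 0, which [L] has to avoid. *)
Definition application_context (A : formula) (d : nat) (L : seq link) (x : nat) : rooted :=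
  Rooted (Cut 0 d A :: [:: Hole 0 A] ++ L) x.

Lemma application_context_correct A d L x :
  extended_net L [:: pos x boolF; neg d A] -> ~~ has is_hole L ->
  {in names L, forall y, 0 < y} ->
  one_hole_context (application_context A d L x) A boolF.
Proof.
move=> n nh L0; split.
- have n' : extended_net L [:: neg d A; pos x boolF] by apply: net_reorder n _; perm_by_count.
  apply: net_cut (net_hole 0 A) n' _; apply/disjoint_namesP => y.
  by rewrite inE => /eqP-> /L0.
- by move: nh; rewrite has_count -leqNgt leqn0 => /eqP /= ->.
- by exists 0; rewrite !inE eqxx orbT.
Qed.

Lemma application_context_result A B d L x q e T e1 :
  extended_net L [:: pos x boolF; neg d (fsubst B A)] -> ~~ has is_hole L ->
  {in names L, forall y, 0 < y} ->
  experiment e L -> e x = own_point q ->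
  closed_net T A -> experiment e1 (links T) -> e1 (ccl T) = e d ->
  net_eq (plug (application_context (fsubst B A) d L x) (net_subst B T)) (bool_net q).
Proof.
move=> n nh L0 he ex [nT nhT] he1 e1d.
set C := application_context _ _ _ _; set A' := fsubst B A in n C *.
pose m := (\max_(y <- names (links C)) y).+1.
pose f y := if y == ccl T then 0 else y + m.
have finj : injective f.
  move=> a b; rewrite /f; case: eqP => [->|_]; case: eqP => [->|_] //; rewrite /m;
    by clear; lia.
have Lm y : y \in names L -> y < m.
  move=> hy; rewrite /m ltnS; apply: (leq_bigmax_seq (F := id)) => //.
  by rewrite /C /= !mem_names_cons hy !orbT.
pose K := map (link_map f id) (map (link_map id (fsubst B)) (links T)).
have linksE : links (plug C (net_subst B T)) = Cut 0 d A' :: K ++ L.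
  rewrite /plug /= -/m -/f -/K; congr (_ :: _ ++ _).
  exact: (fill_without_hole
    (fun h => map (link_map (fun y => if y == ccl T then h else y + m) id) _)).
have nK : extended_net K [:: pos 0 A'].
  have := net_map (f := id) (fun A1 A2 => erefl (fsubst B (A1 ⊸ A2))) nT (fun _ _ _ _ => id).
  move=> /(net_map (f := f) (g := id) (fun _ _ => erefl)) /(_ (in2W finj)).
  by rewrite /= /occ_map /= /f eqxx.
have nhK : ~~ has is_hole K by rewrite !has_hole_map.
have namesK y : y \in names K -> y = 0 \/ m <= y.
  rewrite /K !names_link_map => /mapP[z _ ->]; rewrite /f.
  by case: eqP => _; [left|right; apply: leq_addl].
have dis : disjoint_names K L.
  apply/disjoint_namesP => y /namesK[->|my] hy; first by have := L0 _ hy.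
  by have := Lm _ hy; rewrite ltnNge my.
have n' : extended_net L [:: neg d A'; pos x boolF] by apply: net_reorder n _; perm_by_count.
have nP := net_cut nK n' dis; rewrite /= -linksE in nP.
have nhP : ~~ has is_hole (links (plug C (net_subst B T))).
  by rewrite linksE /= has_cat negb_or nhK.
(* Three kinds of names: 0 for the identified conclusion, those of [L] below [m], and those of [T]
   shifted by [m]. *)
pose E y := if y == 0 then e d else if y < m then e y else e1 (y - m).
have dL : d \in names L by apply: (net_conclusion_name (o := neg d A') n'); rewrite mem_head.
have xL : x \in names L by apply: (net_conclusion_name (o := pos x boolF) n); rewrite mem_head.
have EL y : y \in names L -> E y = e y.
  by move=> hy; rewrite /E (Lm _ hy); case: eqP => // y0; have := L0 _ hy; rewrite y0.
have hE : experiment E (links (plug C (net_subst B T))).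
  rewrite linksE; apply/experiment_cons; split; first by rewrite /= (EL d) // /E eqxx.
  apply/experiment_cat; split.
    apply/experiment_map/experiment_map; apply: eq_in_experiment he1 => y _ /=.
    rewrite /f; case: eqP => [->|_]; first by rewrite /E eqxx.
    by rewrite /E addn_eq0 andbF ltnNge leq_addl addnK.
  by apply: eq_in_experiment he => y hy; rewrite EL.
(* The result of the experiment survives normalisation and identifies the normal form. *)
have [N [red nN hN same]] := net_normalisation nP nhP.
have [|e' he' ee'] := (same E).1; first by exists E.
have rep : represents N x 3 (bool_term q).
  by apply: (normal_bool_net nN hN he'); rewrite ee' ?mem_head // EL.
have c6 : ccl (bool_net q) = 6 by case: (q).
exists N, (links (bool_net q)); split.
- by split=> //; apply: normal_links_normal.
- by split; [apply: rt_refl|apply: normal_links_normal; apply: bool_net_normal].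
- rewrite c6; apply: (represents_eq_normal _ rep (bool_net_represents q)).
  by case: (q) => i; rewrite !inE => /or3P[] /eqP->.
Qed.

(** The term is read from the normal form, but its experiments are carried back to [T], the net that
    gets plugged. *)
Lemma closed_net_term A T :
  closed_net T A -> formula_order A < 4 ->
  exists N s,
    [/\ normal_form (links T) N, represents N (ccl T) (size (args A)) s,
        perm_eq (vars s) (iota 0 (size (args A))), has_arity (arg_arity A) s 0
      & forall v w, evals v s w ->
          exists2 e, experiment e (links T)
                   & e (ccl T) = foldr pair w (map v (iota 0 (size (args A))))].
Proof.
move=> [n nh] oA; have [N [red nN hN same]] := net_normalisation n nh.
have [s [rep pv ha ex]] := closed_normal_net_term nN hN oA.
exists N, s; split=> //; first by split=> //; apply: normal_links_normal.
move=> v w /ex[e he ev]; have [|e' he' ee'] := (same e).2; first by exists e.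
by exists e' => //; rewrite ee' ?mem_head.
Qed.

Unset Implicit Arguments.

Theorem theorem5p1 (A : formula) (T1 T2 : rooted)
    (hT1 : closed_net T1 A) (hT2 : closed_net T2 A)
    (hA : formula_order A < 4) (hneq : ~ net_eq T1 T2) :
  exists C : rooted,
    [/\ one_hole_context C (fsubst boolF A) boolF,
        net_eq (plug C (net_subst boolF T1)) zero_net
      & net_eq (plug C (net_subst boolF T2)) one_net].
Proof.
have [N1 [s1 [nf1 rep1 pv1 ar1 ex1]]] := closed_net_term hT1 hA.
have [N2 [s2 [nf2 rep2 pv2 ar2 ex2]]] := closed_net_term hT2 hA.
have ne : s1 <> s2.
  move=> e; apply: hneq; exists N1, N2; split=> //.
  rewrite -e in rep2; apply: (represents_eq_normal _ rep1 rep2).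
  by move=> i; rewrite (perm_mem pv1) mem_iota.
have u1 : uniq (vars s1) by rewrite (perm_uniq pv1) iota_uniq.
have u2 : uniq (vars s2) by rewrite (perm_uniq pv2) iota_uniq.
have [v [rv ev1 ev2 _ _]] := linear_terms_separable ar1 ar2 u1 u2 ne.
(* The result prescribed at [q] is [own_point q]. The final argument 1 bounds the names from below
   and keeps 0 for the hole. *)
have [L [x [[|d [|? ?]] [e [n // sz nh L1 he]]]]] :=
  realized_applications (v := fun i q => v q i) (w := own_point) (order3_args hA)
    (fun i _ => rv i) (fun q => erefl) 1.
have [e1 he1 ec1] := ex1 _ _ ev1.
have [e2 he2 ec2] := ex2 _ _ ev2.
exists (application_context (fsubst boolF A) d L x); split.
- exact: application_context_correct.
- have [h1 h2 [h3]] := he false.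
  by apply: (application_context_result (q := false) (e := e false) (e1 := e1)) => //; rewrite h3.
- have [h1 h2 [h3]] := he true.
  by apply: (application_context_result (q := true) (e := e true) (e1 := e2)) => //; rewrite h3.
Qed.
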